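(* Assume the standing assumptions and suppose $F\in\mathcal S^*$. Let $\sigma\le\infty$ be any stopping time (with respect to an admissible filtration). Then $$\lim_{x\to\infty}\frac{\mathbf P(M_\sigma>x)}{\overline F(x)}=\mathbf E\sigma,$$ where the limit is understood to be $+\infty$ if $\mathbf E\sigma=\infty$.
   Context: Standing assumptions: $\{\xi_n\}_{n\ge1}$ are i.i.d. real random variables with common distribution function $F$ and finite mean $\mathbf E\xi_1=-m<0$. $F$ is long-tailed: $\overline F(x):=1-F(x)>0$ for all $x$, and $\overline F(x-c)/\overline F(x)\to1$ as $x\to\infty$ for every fixed $c>0$. Notation: $S_0=0$ and $S_n=\sum_{i=1}^n\xi_i$; $M_n=\max_{0\le i\le n}S_i$; $M=\sup_{n\ge0}S_n$. Admissible filtration: a stopping time $\sigma$, with values in $\{0,1,2,\dots\}\cup\{\infty\}$, is taken with respect to a filtration $\{\mathcal F_n\}_{n\ge0}$ such that for each $n$ the variable $\xi_n$ is $\mathcal F_n$-measurable and $\xi_{n+1}$ is independent of $\mathcal F_n$. Maximum up to a stopping time: $M_\sigma=\max_{0\le i\le\sigma}S_i$, which means $\sup_{i\ge0}S_i$ on $\{\sigma=\infty\}$. The class $\mathcal S^*$: a distribution function $G$ on $\mathbb R$ belongs to $\mathcal S^*$ iff $\overline G(x)>0$ for all $x$ and $$\int_0^x\overline G(x-y)\overline G(y)\,dy\sim 2m_{G^+}\overline G(x)\quad\text{as }x\to\infty,$$ where $m_{G^+}=\int_0^\infty\overline G(t)\,dt$. *)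

(* Defs.v *)
From HB Require Import structures.
From mathcomp Require Import all_boot all_order all_algebra.
From mathcomp Require Import all_classical all_reals all_analysis.
Set Implicit Arguments. Unset Strict Implicit. Unset Printing Implicit Defensive.
Import Order.TTheory GRing.Theory Num.Theory.
Import numFieldNormedType.Exports.
Local Open Scope classical_set_scope.
Local Open Scope ring_scope.

Section Defs.
Context {R : realType} {d : measure_display} {Omega : measurableType d}.
Variable P : probability Omega R.

Definition tail (G : R -> R) (x : R) : R := 1 - G x.

Definition mplus (G : R -> R) : \bar R :=
  (\int[lebesgue_measure]_(t in `[0%R, +oo[%classic) (tail G t)%:E)%E.

(* the class S^* (with m_{G^+} finite, as required for the asymptotic
   equivalence to make sense) *)
Definition in_Sstar (G : R -> R) : Prop :=
  (forall x, 0 < tail G x) /\ (mplus G < +oo)%E /\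
  (fun x => fine (\int[lebesgue_measure]_(y in `[0%R, x]%classic)
                   (tail G (x - y) * tail G y)%:E)%E / tail G x)
    @ +oo --> (2 * fine (mplus G) : R).

Definition long_tailed (G : R -> R) : Prop :=
  (forall x, 0 < tail G x) /\
  forall c : R, 0 < c -> (fun x => tail G (x - c) / tail G x) @ +oo --> (1 : R).

Definition mutually_independent (xi : nat -> Omega -> R) : Prop :=
  forall (s : seq nat) (B : nat -> set R),
    uniq s -> all (fun i => 0 < i)%N s -> (forall i, measurable (B i)) ->
    P (\big[setI/setT]_(i <- s) (xi i @^-1` B i)) =
    (\prod_(i <- s) P (xi i @^-1` B i))%E.

Definition admissible_filtration (xi : nat -> Omega -> R)
    (Fil : nat -> set (set Omega)) : Prop :=
  (forall n, sigma_algebra setT (Fil n)) /\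
  (forall n, Fil n `<=` measurable) /\
  (forall n m, (n <= m)%N -> Fil n `<=` Fil m) /\
  (forall n, (0 < n)%N -> forall B, measurable B -> Fil n (xi n @^-1` B)) /\
  (forall n A B, Fil n A -> measurable B ->
      P (A `&` xi n.+1 @^-1` B) = (P A * P (xi n.+1 @^-1` B))%E).

(* stopping times with values in {0,1,...} \cup {oo}; None stands for oo *)
Definition stopping_time (Fil : nat -> set (set Omega))
    (sigma : Omega -> option nat) : Prop :=
  forall n, Fil n [set w | sigma w = Some n].

Definition le_st (i : nat) (s : option nat) : Prop :=
  match s with Some n => (i <= n)%N | None => True end.

Definition S (xi : nat -> Omega -> R) (n : nat) (w : Omega) : R :=
  \sum_(1 <= i < n.+1) xi i w.

Definition M_st (xi : nat -> Omega -> R) (sigma : Omega -> option nat)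
    (w : Omega) : \bar R :=
  ereal_sup [set (S xi i w)%:E | i in [set i | le_st i (sigma w)]].

Definition st_ext (sigma : Omega -> option nat) (w : Omega) : \bar R :=
  match sigma w with Some n => (n%:R)%:E | None => +oo%E end.

Definition E_st (sigma : Omega -> option nat) : \bar R :=
  (\int[P]_w st_ext sigma w)%E.

End Defs.

(* Main.v *)
Require Import Defs.
From HB Require Import structures.
From mathcomp Require Import all_boot all_order all_algebra.
From mathcomp Require Import all_classical all_reals all_analysis.
From mathcomp Require Import measurable_realfun ring lra.
Set Implicit Arguments.
Unset Strict Implicit.
Unset Printing Implicit Defensive.
Import Order.TTheory GRing.Theory Num.Theory.
Import numFieldNormedType.Exports.
Local Open Scope classical_set_scope.
Local Open Scope ring_scope.

(** Lyapunov function proof.  Write [T] for the tail of [F].  For the upper bound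
    we construct, for [eps > 0] and large [x], a function [h >= 0] with
    [h 0 = 0], [h s >= 1] for [s > x], and
    [E h(s + xi) <= h s + (1 + eps) T x] for [s <= x]; optional stopping at the
    first passage over [x] then gives [P(M_sigma > x) <= (1 + eps) T x E sigma].
    The function is [h t = \int_(u < t) kappa u du], where [kappa u] is a multiple
    of [T (max (x - D - u) A)] (the rate at which a walk drifting to the left
    jumps over [x]) times a ramp that rises from 0 to 1 so slowly that a single
    step does not notice it.  In the region where the ramp equals 1, upward jumps
    of size [v] contribute [\int T(y - v) T(v) dv], with [y = x - D - s]; by the
    definition of [S^*] the main contributions come from bounded [v] and from
    [y - v] bounded, and the truncation at [A] keeps the latter below half of the
    surplus of the negative drift, which compensates the rest.  The lower bound is the one big jump
    estimate for long-tailed [F]. *)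

(** * Lebesgue integrals *)

Section LebesgueReflection.
Context {R : realType}.
Local Notation mu := (@lebesgue_measure R).

(** The image of Lebesgue measure under [x |-> c - x] gives every interval its length, so by
    uniqueness it is Lebesgue measure. *)
Lemma ge0_integral_reflect (f : R -> \bar R) (c : R) :
  measurable_fun setT f -> (forall x, 0 <= f x)%E ->
  (\int[mu]_x f x = \int[mu]_x f (c - x)%R)%E.
Proof.
move=> mf f0.
pose phi : R -> measurableTypeR R := fun x => c - x.
have mphi : measurable_fun setT phi by exact: measurable_funB.
pose phiM : {mfun R >-> measurableTypeR R} := HB.pack phi (isMeasurableFun.Build _ _ _ _ phi mphi).
have -> : (\int[mu]_x f (c - x)%R = \int[pushforward mu phiM]_x f x)%E.
  by rewrite ge0_integral_pushforward// preimage_setT.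
apply: eq_measure_integral => A mA _.
apply: (@lebesgue_measure_unique R (pushforward mu phiM)) => //.
move=> _ [[a b]] _ <-.
rewrite /= /pushforward.
have -> : phi @^-1` `]a, b] = `[c - b, c - a[%classic.
  apply/seteqP; split => x /=; rewrite /phi !in_itv/= => /andP[? ?]; apply/andP; split; lra.
rewrite !lebesgue_measure_itv/= !lte_fin ltrD2l ltrN2.
by case: ifP => // _; rewrite !EFinB; congr (_%:E); ring.
Qed.

Lemma ge0_integral_translate (f : R -> \bar R) (s : R) :
  measurable_fun setT f -> (forall x, 0 <= f x)%E ->
  (\int[mu]_x f x = \int[mu]_x f (s + x)%R)%E.
Proof.
move=> mf f0.
(* A translation is the composite of two reflections. *)
rewrite (@ge0_integral_reflect _ s)// (@ge0_integral_reflect _ 0)//.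
  by apply: eq_integral => x _; rewrite sub0r opprK.
by apply: measurableT_comp => //; exact: measurable_funB.
Qed.

End LebesgueReflection.

Lemma integral_mulindic d (T : measurableType d) (R : realType)
  (mu : {measure set T -> \bar R}) (D : set T) (g : T -> R) :
  (\int[mu]_(x in D) (g x)%:E = \int[mu]_x (g x * \1_D x)%:E)%E.
Proof.
rewrite integral_mkcond; apply: eq_integral => x _.
by rewrite patchE indicE; case: ifP => _; rewrite ?mulr1 ?mulr0.
Qed.

(** Monotone convergence along the integers finds one good index; monotonicity of [A] extends the
    bound to all larger real [K]. *)
Lemma ge0_integral_exhaust (R : realType) (f : R -> \bar R) (D : set R)
    (A : R -> set R) (c : R) :
  measurable_fun setT f -> (forall x, 0 <= f x)%E ->
  (forall K, measurable (A K)) -> {homo A : x y / x <= y >-> x `<=` y} ->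
  D = \bigcup_n A n%:R ->
  (c%:E < \int[lebesgue_measure]_(x in D) f x)%E ->
  exists K0 : R, 0 < K0 /\ forall K, K0 <= K ->
    (c%:E < \int[lebesgue_measure]_(x in A K) f x)%E.
Proof.
move=> mf f0 mA Amono DE cD.
have cv : (\int[lebesgue_measure]_(x in A n%:R) f x)%E @[n --> \oo] -->
    (\int[lebesgue_measure]_(x in D) f x)%E.
  rewrite DE; apply: ge0_nondecreasing_set_cvg_integral => //.
  - by move=> m n mn; apply/subsetPset/Amono; rewrite ler_nat.
  - by move=> n; exact: mA.
  - by move=> n; exact: measurable_funTS.
have [n _ /(_ n (leqnn n)) /= cn] := cv _ (open_ereal_gt_ereal cD).
exists n.+1%:R; split=> [|K nK]; first by rewrite ltr0n.
apply: (lt_le_trans cn); apply: ge0_subset_integral.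
- exact: mA.
- exact: mA.
- exact: measurable_funTS.
- by [].
- by apply: Amono; rewrite (le_trans _ nK)// ler_nat.
Qed.

(** * The Lyapunov density of a tail in S^* *)

(** Here [a] is the mean upward step, [q] a truncated mean downward step, and [m'] half of the
    surplus. The first inequality makes the drift nonpositive where the ramp is 1; the second,
    divided by [m'], bounds the drift on the rest by [1 + eps] times the tail. *)
Lemma drift_constants (R : realType) (a q eps m' : R) : 0 <= a -> a < q -> 0 < eps ->
  0 < m' -> m' = (q - a) / 2 ->
  exists eta : R, [/\ 0 < eta, eta <= 1,
    (1 + eta) * (1 + eta) * a + eta + m' <= (1 - eta) * (1 - eta) * q &
    (m' + eta * (4 * a + 1 + 2 * q)) * (1 + eta) <= (1 + eps) * m'].
Proof.
move=> a0 aq eps0 m'0 m'E.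
pose c := 4 * a + 1 + 2 * q.
have c0 : 0 < c by rewrite /c; lra.
(* As [q - a = 2 * m'], the first inequality follows from [eta * c <= m']. Expanding the second with
   [1 + eta <= 2] leaves [eta * (m' + 2 * c) <= eps * m']. *)
pose eta := Num.min 1 (Num.min (m' / c) (eps * m' / (m' + 2 * c))).
have e1 : eta <= 1 by rewrite /eta ge_min lexx.
have e2 : eta * c <= m' by rewrite -ler_pdivlMr// /eta !ge_min lexx orbT.
have c2 : 0 < m' + 2 * c by lra.
have e3 : eta * (m' + 2 * c) <= eps * m'.
  by rewrite -ler_pdivlMr// /eta !ge_min lexx !orbT.
have e0 : 0 < eta.
  by rewrite /eta !lt_min ltr01 (divr_gt0 m'0 c0) (divr_gt0 (mulr_gt0 eps0 m'0) c2).
exists eta; split => //.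
  have h1 : (1 + eta) * (1 + eta) * a <= (1 + 3 * eta) * a.
    by apply: ler_wpM2r => //; nra.
  have h2 : (1 - 2 * eta) * q <= (1 - eta) * (1 - eta) * q.
    by apply: ler_wpM2r; [lra|nra].
  have ea : 0 <= eta * a by rewrite mulr_ge0// ltW.
  move: e2; rewrite /c; lra.
have h : eta * c * (1 + eta) <= 2 * (eta * c).
  have := mulr_gt0 e0 c0.
  nra.
rewrite -/c; lra.
Qed.

(** If [p >= eta], the last hypothesis multiplied by [p] absorbs the main terms and leaves errors of
    order [eta]. If [p < eta], the downward term vanishes, but the upward one is at most
    [4 * eta * a]. *)
Lemma drift_bracket (R : realType) (a q m' eta p : R) : 0 <= a -> a < q -> 0 <= m' ->
  0 < eta -> eta <= 1 -> 0 <= p -> p <= 1 ->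
  (1 + eta) * (1 + eta) * a + eta + m' <= (1 - eta) * (1 - eta) * q ->
  (p + eta) * (1 + eta) * a + eta + m' - Num.max 0 (p - eta) * (1 - eta) * q
    <= m' + eta * (4 * a + 1 + 2 * q).
Proof.
move=> a0 aq m'0 eta0 eta1 p0 p1 etam.
have ea : 0 <= eta * a by rewrite mulr_ge0// ltW.
have eq0 : 0 <= eta * q by rewrite mulr_ge0//; lra.
have pa : p * a <= a by rewrite ler_piMl.
case: (leP 0 (p - eta)) => pe.
  have h1 : eta * (eta * a) <= eta * a by rewrite ler_piMl.
  have h2 : eta * (eta * q) >= 0 by rewrite mulr_ge0// ltW.
  have h3 := ler_wpM2l p0 etam.
  have h4 : p * eta <= eta by rewrite ler_piMl// ltW.
  have h5 : p * m' <= m' by rewrite ler_piMl.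
  have h7 : 0 <= p * (eta * a) by rewrite mulr_ge0.
  have h8 : p * (eta * q) >= 0 by rewrite mulr_ge0.
  nra.
rewrite !mul0r subr0.
have : (p + eta) * (1 + eta) * a <= (2 * eta * 2) * a.
  by apply: ler_wpM2r => //; apply: ler_pM; lra.
lra.
Qed.

Section Tail.
Context {R : realType}.
Local Notation mu := (@lebesgue_measure R).
Variable T : R -> R.
Hypothesis Tni : {homo T : x y /~ x <= y}.
Hypothesis T0 : forall x, 0 < T x.
Hypothesis T1 : forall x, T x <= 1.
Hypothesis Tlong : forall c : R, 0 < c ->
  (fun x => T (x - c) / T x) @ +oo --> (1 : R).
Variable a : R.
Hypothesis Ta : (\int[mu]_(t in `[0%R, +oo[%classic) (T t)%:E = a%:E)%E.
Hypothesis Tconv :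
  (fun x => fine (\int[mu]_(y in `[0%R, x]%classic) (T (x - y) * T y)%:E)%E / T x)
    @ +oo --> (2 * a : R).

Lemma measurable_tail : measurable_fun setT T.
Proof. by apply: nonincreasing_measurable => // x y xy; exact: Tni. Qed.

Lemma tail_ge0 x : 0 <= T x. Proof. exact/ltW. Qed.

Lemma near_tail_sub (c eta : R) : 0 < eta ->
  \forall x \near +oo, T (x - c) <= (1 + eta) * T x.
Proof.
move=> eta0; case: (ltP 0 c) => [c0|c0].
  have /cvgrPdist_lt/(_ _ eta0) := Tlong c0.
  apply: filterS => x; rewrite distrC => /ltr_distlDr.
  by rewrite addrC ltr_pdivrMr// addrC => /ltW.
near=> x; have xc : T (x - c) <= T x by apply: Tni; lra.
have := T0 x; nra.
Unshelve. all: by end_near. Qed.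

Lemma near_tail_add (c eta : R) : 0 < eta -> eta <= 1 ->
  \forall x \near +oo, (1 - eta) * T x <= T (x + c).
Proof.
move=> eta0 eta1.
have [M [_ HM]] := near_tail_sub c eta0.
exists (M - c); split; rewrite ?num_real// => x Mx /=.
have /HM /= : M < x + c by lra.
rewrite addrK => h; have := T0 x; have := T0 (x + c); nra.
Qed.

(* The pieces [0, K] and [y - K, y] of the convolution already account for
   [2 a T y] up to [eta], which leaves [eta T y] for the middle piece. *)
Lemma tail_convolution (eta : R) : 0 < eta ->
  exists K0 : R, 0 < K0 /\ forall K, K0 <= K -> \forall y \near +oo,
    (\int[mu]_(v in `[K, (y - K)%R]%classic) (T (y - v) * T v)%:E <= (eta * T y)%:E)%E.
Proof.
move=> eta0.
have mT := measurable_tail.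
have mTE : measurable_fun setT (EFin \o T) by exact: measurableT_comp.
have [|||||K0 [K00 HK0]] := @ge0_integral_exhaust R (EFin \o T) `[0, +oo[%classic
  (fun K => `[0, K[%classic) (a - eta / 4) mTE.
- by move=> x; rewrite lee_fin tail_ge0.
- by move=> K; exact: measurable_itv.
- by move=> x y xy z /=; rewrite !in_itv/= => /andP[-> /lt_le_trans]; apply.
- apply/seteqP; split => x /=; rewrite ?in_itv/= andbT => x0.
    exists (Num.truncn x).+1 => //=; rewrite in_itv/= x0 /=.
    exact: truncnS_gt.
  by case: x0 => n _ /=; rewrite in_itv/= => /andP[].
- by rewrite Ta lte_fin; lra.
exists K0; split => // K KK0.
have {}HK0 := HK0 _ KK0.
set bK := (\int[mu]_(x in `[0%R, K[%classic) (T x)%:E)%E in HK0.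
have : \forall y \near +oo, fine (\int[mu]_(v in `[0%R, y]%classic)
    (T (y - v) * T v)%:E)%E / T y < 2 * a + eta / 2.
  have eta2 : 0 < eta / 2 by lra.
  have /cvgrPdist_lt/(_ _ eta2) := Tconv.
  by apply: filterS => y; rewrite distrC => /ltr_distlDr.
move=> near_conv; near=> y.
have y2K : 2 * K < y by near: y; apply: nbhs_pinfty_gt; rewrite num_real.
have K0' : 0 < K by lra.
have Iy : fine (\int[mu]_(v in `[0%R, y]%classic) (T (y - v) * T v)%:E)%E / T y
    < 2 * a + eta / 2 by near: y.
have mg : measurable_fun setT (fun v : R => T (y - v) * T v).
  by apply: measurable_funM => //; apply: measurableT_comp => //; exact: measurable_funB.
have g0 v : 0 <= T (y - v) * T v by rewrite mulr_ge0 ?tail_ge0.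
(* [fine] sends an infinite integral to 0, so finiteness is required before the bound on the
   quotient becomes a bound on the integral. *)
have Ifin : (\int[mu]_(v in `[0%R, y]%classic) (T (y - v) * T v)%:E < +oo)%E.
  apply: (@le_lt_trans _ _ (\int[mu]_(v in `[0%R, y]%classic) (cst 1%:E) v)%E).
    apply: ge0_le_integral => //=.
    - by move=> x _; rewrite lee_fin.
    - by apply/measurable_EFinP; exact: measurable_funTS.
    - move=> x _; rewrite lee_fin; have := T1 x; have := T1 (y - x).
      have := tail_ge0 x; have := tail_ge0 (y - x); nra.
  rewrite integral_cst//= mul1e lebesgue_measure_itv/=.
  by case: ifP => // _; rewrite oppr0 adde0 ltry.
have {Iy} : (\int[mu]_(v in `[0%R, y]%classic) (T (y - v) * T v)%:E
    <= ((2 * a + eta / 2) * T y)%:E)%E.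
  move: Iy; rewrite ltr_pdivrMr// => /ltW.
  by rewrite -lee_fin fineK// ge0_fin_numE//; apply: integral_ge0 => x _; rewrite lee_fin.
have -> : `[0, y]%classic = (`[0, K[ `|` (`[K, y - K] `|` `]y - K, y]))%classic.
  apply/seteqP; split => v /=; rewrite !in_itv/=.
    move=> /andP[v0 vy]; case: (ltP v K) => vK; first by left; rewrite v0.
    by right; case: (leP v (y - K)) => ?; [left|right]; rewrite ?vK.
  by move=> [|[]] /andP[? ?]; apply/andP; split; lra.
rewrite ge0_integral_setU//=; last 4 first.
- by apply: measurableU; exact: measurable_itv.
- by apply/measurable_EFinP; exact: measurable_funTS.
- by move=> x _; rewrite lee_fin.
- apply/disj_setPS => v [/=]; rewrite !in_itv/= => /andP[? ?] [|] /andP[? ?]; lra.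
rewrite ge0_integral_setU//=; last 3 first.
- by apply/measurable_EFinP; exact: measurable_funTS.
- by move=> x _; rewrite lee_fin.
- by apply/disj_setPS => v [/=]; rewrite !in_itv/= => /andP[? ?] /andP[? ?]; lra.
set J := (X in (_ + (X + _))%E).
have TybK : ((a - eta / 4) * T y)%:E = ((T y)%:E * (a - eta / 4)%:E)%E.
  by rewrite -EFinM mulrC.
(* On this piece [T (y - v) >= T y]. Removing two pieces of at least [(a - eta / 4) * T y] from
   [(2 * a + eta / 2) * T y] leaves exactly [eta * T y]. *)
have I1 : (((a - eta / 4) * T y)%:E <=
    \int[mu]_(v in `[0%R, K[%classic) (T (y - v) * T v)%:E)%E.
  rewrite TybK; apply: (@le_trans _ _ ((T y)%:E * bK)%E).
    by rewrite lee_pmul2l ?lte_fin ?ltW.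
  rewrite -ge0_integralZl_EFin//; last 3 first.
  - by move=> x _; rewrite lee_fin tail_ge0.
  - by apply/measurable_EFinP; exact: measurable_funTS.
  - exact: tail_ge0.
  apply: ge0_le_integral => //=.
  - by move=> x _; rewrite lee_fin mulr_ge0 ?tail_ge0.
  - by apply/measurable_EFinP; apply: measurable_funTS; exact: measurable_funM.
  - by apply/measurable_EFinP; exact: measurable_funTS.
  - move=> x; rewrite in_itv/= => /andP[? ?].
    rewrite lee_fin ler_wpM2r ?tail_ge0//; apply: Tni; lra.
(* The reflection [v |-> y - v] swaps the two factors and carries the first piece to the last. *)
have I3 : (((a - eta / 4) * T y)%:E <=
    \int[mu]_(v in `](y - K)%R, y]%classic) (T (y - v) * T v)%:E)%E.
  apply: (le_trans I1).
  rewrite integral_mulindic [in leRHS]integral_mulindic.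
  rewrite [in leLHS](@ge0_integral_reflect _ _ y); last 2 first.
  - by apply/measurable_EFinP; apply: measurable_funM => //; exact/measurable_indicP.
  - by move=> x; rewrite lee_fin mulr_ge0.
  rewrite le_eqVlt; apply/orP; left; apply/eqP; apply: eq_integral => x _.
  congr (_%:E); rewrite subKr [T x * _]mulrC; congr (_ * _).
  rewrite !indicE; congr ((_ : bool)%:R); apply/idP/idP; rewrite !inE/= !in_itv/=;
    move=> /andP[? ?]; apply/andP; split; lra.
move=> H.
have [J0 Jfin] : (0 <= J)%E /\ J \is a fin_num.
  have J0 : (0 <= J)%E by apply: integral_ge0 => x _; rewrite lee_fin.
  split => //; rewrite ge0_fin_numE//.
  apply: le_lt_trans Ifin; apply: ge0_subset_integral => //.
  - by apply/measurable_EFinP; exact: measurable_funTS.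
  - by move=> x _; rewrite lee_fin.
  - by move=> v /=; rewrite !in_itv/= => /andP[? ?]; apply/andP; split; lra.
have := le_trans (leeD I1 (leeD (lexx J) I3)) H.
rewrite -(fineK Jfin) -!EFinD !lee_fin => ?.
change (J <= (eta * T y)%:E)%E; rewrite -(fineK Jfin) lee_fin; lra.
Unshelve. all: by end_near. Qed.

(** The rectangle of height [T A] over [[0, A]] lies under the graph of [T]. This later makes
    [T A * K] small for large [A]. *)
Lemma tail_mul_le (A : R) : 0 < A -> T A * A <= a.
Proof.
move=> A0.
rewrite -lee_fin -Ta.
have mTE D : measurable_fun D (EFin \o T).
  by apply/measurable_EFinP; apply: measurable_funTS; exact: measurable_tail.
apply: (@le_trans _ _ (\int[mu]_(t in `[0%R, A]%classic) (T A)%:E)%E).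
  by rewrite integral_cst//= lebesgue_measure_itv/= lte_fin A0 oppr0 adde0 EFinM.
apply: (@le_trans _ _ (\int[mu]_(t in `[0%R, A]%classic) (T t)%:E)%E).
  apply: ge0_le_integral => //=.
  - by move=> x _; rewrite lee_fin tail_ge0.
  - exact: mTE.
  - by move=> x; rewrite in_itv/= => /andP[_ xA]; rewrite lee_fin; exact: Tni.
apply: ge0_subset_integral => //; first exact: mTE.
- by move=> x _; rewrite lee_fin tail_ge0.
- by move=> x /=; rewrite !in_itv/= => /andP[->].
Qed.

Lemma ge0_le_integral_add (f g1 g2 : R -> R) :
  measurable_fun setT f -> measurable_fun setT g1 -> measurable_fun setT g2 ->
  (forall x, 0 <= f x) -> (forall x, 0 <= g1 x) -> (forall x, 0 <= g2 x) ->
  (forall x, f x <= g1 x + g2 x) ->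
  (\int[mu]_x (f x)%:E <= \int[mu]_x (g1 x)%:E + \int[mu]_x (g2 x)%:E)%E.
Proof.
move=> mf mg1 mg2 f0 g10 g20 fg.
rewrite -ge0_integralD//; last 4 first.
- by move=> x _; rewrite lee_fin.
- exact/measurable_EFinP.
- by move=> x _; rewrite lee_fin.
- exact/measurable_EFinP.
apply: ge0_le_integral => //=.
- by move=> x _; rewrite lee_fin.
- exact/measurable_EFinP.
- by apply: emeasurable_funD; exact/measurable_EFinP.
- by move=> x _; rewrite -EFinD lee_fin.
Qed.

Lemma integral_cst_mulindic_itv (c l r : R) : l <= r ->
  (\int[mu]_x (c * \1_(`[l, r]%classic) x)%:E = (c * (r - l))%:E)%E.
Proof.
move=> lr; rewrite -(@integral_mulindic _ _ _ mu `[l, r]%classic (fun=> c))/= integral_cst//=.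
rewrite lebesgue_measure_itv/= lte_fin; case: ltP => [_|rl]; first by rewrite -EFinB -EFinM.
have -> : r = l by apply/eqP; rewrite eq_le lr rl.
by rewrite subrr mulr0 mule0.
Qed.

Lemma measurable_mulindic (f : R -> R) (D : set R) : measurable D ->
  measurable_fun setT f -> measurable_fun setT (fun x => f x * \1_D x).
Proof. by move=> mD mf; apply: measurable_funM => //; exact/measurable_indicP. Qed.

Lemma measurable_EFinM (f g : R -> R) (D : set R) :
  measurable_fun setT f -> measurable_fun setT g ->
  measurable_fun D (fun x => (f x * g x)%:E).
Proof.
by move=> mf mg; apply/measurable_EFinP; apply: measurable_funTS; exact: measurable_funM.
Qed.

(** * Contributions of upward and downward steps to the drift *)

Section Drift.
Variables (phi : R -> R) (W e K A D eta : R).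
Hypotheses (mphi : measurable_fun setT phi)
  (phi0 : forall u, 0 <= phi u) (phiW : forall u, phi u <= W)
  (phiK : forall u v : R, 0 <= v -> v <= K -> phi (u + v) <= phi u + e).
Hypotheses (K0 : 0 < K) (D0 : 0 < D) (AK : 2 * K <= A) (eta0 : 0 < eta) (W0 : 0 < W).

(* [G] and [phi] are the truncated tail and the ramp (divided by the drift
   constant); [dens s y] is the Lyapunov density seen from the position [s],
   where [y] is the shifted distance from [s] to the level. *)
Let G y := T (Num.max y A).

Let GT y : G y <= T y. Proof. by apply: Tni; rewrite le_max lexx. Qed.
Let GA y : G y <= T A. Proof. by apply: Tni; rewrite le_max lexx orbT. Qed.
Let G0 y : 0 <= G y. Proof. exact: tail_ge0. Qed.
Let mG : measurable_fun setT G.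
Proof.
apply: nonincreasing_measurable => // x y xy; apply: Tni.
by rewrite ge_max !le_max xy lexx orbT.
Qed.

Let dens s y v := phi (s + v) * G (y - v) * \1_(`]-oo, y + D]%classic) v.

Let dens0 s y v : 0 <= dens s y v.
Proof. by rewrite /dens !mulr_ge0// ?phi0. Qed.

Let mdens s y : measurable_fun setT (dens s y).
Proof.
apply: measurable_mulindic => //; apply: measurable_funM.
  by apply: measurableT_comp => //; exact: measurable_funD.
by apply: measurableT_comp => //; exact: measurable_funB.
Qed.

Let a0 : 0 <= a.
Proof. by rewrite -lee_fin -Ta; apply: integral_ge0 => x _; rewrite lee_fin tail_ge0. Qed.

(** Jumps are cut at [K], [y - K], [y] and [y + D]. Up to [K] the ramp gains at most [e] and the
    tail is at most [T (y - K)]. The middle piece is the convolution bounded by hypothesis. On the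
    next two pieces the truncation gives [G <= T A], at a cost proportional to [T A * K] and
    [T A * D]. Beyond [y + D] the density is 0. *)
Lemma upward_drift_far s y : A <= y ->
  T (y - K) <= (1 + eta) * T y ->
  (\int[mu]_(v in `[K, (y - K)%R]%classic) (T (y - v) * T v)%:E <= (eta / 2 * T y)%:E)%E ->
  T A * K * (1 + eta) <= eta / 2 ->
  (\int[mu]_(v in `[0%R, +oo[%classic) (dens s y v * T v)%:E <=
    (((phi s + e) * (1 + eta) * a + W * (eta + T A * D)) * T y)%:E)%E.
Proof.
move: K0 D0 AK eta0 W0 => K0' D0' AK' eta0' W0' Ay TyK conv TAK.
have mT := measurable_tail.
have e0 : 0 <= e by have := @phiK 0 0 (lexx _) (ltW K0); rewrite addr0; lra.
pose g1 v := (phi s + e) * T (y - K) * (T v * \1_(`[0%R, +oo[%classic) v).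
pose g2 v := W * (T (y - v) * T v * \1_(`[K, y - K]%classic) v).
pose g3 v := W * T A * T (y - K) * \1_(`[y - K, y]%classic) v.
pose g4 v := W * T A * T y * \1_(`[y, y + D]%classic) v.
have mconv : measurable_fun setT (fun v : R => T (y - v) * T v).
  by apply: measurable_funM => //; apply: measurableT_comp => //; exact: measurable_funB.
have mg1 : measurable_fun setT g1 by apply: measurable_funM => //; exact: measurable_mulindic.
have mg2 : measurable_fun setT g2 by apply: measurable_funM => //; exact: measurable_mulindic.
have mg3 : measurable_fun setT g3 by exact: measurable_mulindic.
have mg4 : measurable_fun setT g4 by exact: measurable_mulindic.
have se0 : 0 <= phi s + e by rewrite addr_ge0.
have Wge0 := ltW W0.
have g10 v : 0 <= g1 v by rewrite /g1 !mulr_ge0// ?tail_ge0.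
have g20 v : 0 <= g2 v by rewrite /g2 !mulr_ge0// ?tail_ge0.
have g30 v : 0 <= g3 v by rewrite /g3 !mulr_ge0// ?tail_ge0.
have g40 v : 0 <= g4 v by rewrite /g4 !mulr_ge0// ?tail_ge0.
have i1 : (\int[mu]_v (g1 v)%:E <= ((phi s + e) * (1 + eta) * a * T y)%:E)%E.
  rewrite /g1; under eq_integral do rewrite EFinM.
  rewrite ge0_integralZl_EFin//; last 3 first.
  - by move=> x _; rewrite lee_fin mulr_ge0// tail_ge0.
  - by apply/measurable_EFinP; exact: measurable_mulindic.
  - by rewrite mulr_ge0// tail_ge0.
  rewrite -integral_mulindic Ta -EFinM lee_fin.
  have := ler_wpM2l (mulr_ge0 se0 a0) TyK; lra.
have i2 : (\int[mu]_v (g2 v)%:E <= (W * (eta / 2) * T y)%:E)%E.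
  rewrite /g2; under eq_integral do rewrite EFinM.
  rewrite ge0_integralZl_EFin//; last 2 first.
  - by move=> x _; rewrite lee_fin !mulr_ge0// tail_ge0.
  - by apply/measurable_EFinP; exact: measurable_mulindic.
  by rewrite -integral_mulindic -mulrA EFinM; apply: lee_wpmul2l; rewrite ?lee_fin.
have i3 : (\int[mu]_v (g3 v)%:E <= (W * (eta / 2) * T y)%:E)%E.
  rewrite /g3 integral_cst_mulindic_itv ?lee_fin; last by lra.
  rewrite opprB addrCA subrr addr0 -!mulrA ler_pM2l//.
  have := ler_wpM2l (mulr_ge0 (tail_ge0 A) (ltW K0)) TyK.
  have := ler_wpM2r (tail_ge0 y) TAK; lra.
have i4 : (\int[mu]_v (g4 v)%:E <= (W * (T A * D) * T y)%:E)%E.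
  rewrite /g4 integral_cst_mulindic_itv ?lee_fin; last by lra.
  rewrite addrAC subrr add0r; lra.
have -> : ((phi s + e) * (1 + eta) * a + W * (eta + T A * D)) * T y =
   (phi s + e) * (1 + eta) * a * T y + (W * (eta / 2) * T y
   + (W * (eta / 2) * T y + (W * (T A * D)) * T y)) by field.
rewrite integral_mulindic !EFinD.
apply: (le_trans _ (leeD i1 (leeD i2 (leeD i3 i4)))).
have m34 : measurable_fun setT (fun v => g3 v + g4 v) by exact: measurable_funD.
have m234 : measurable_fun setT (fun v => g2 v + (g3 v + g4 v)) by exact: measurable_funD.
have p34 v : 0 <= g3 v + g4 v by rewrite addr_ge0.
have p234 v : 0 <= g2 v + (g3 v + g4 v) by rewrite addr_ge0.
apply: (@le_trans _ _ (\int[mu]_v (g1 v)%:E + \int[mu]_v (g2 v + (g3 v + g4 v))%:E)%E); last first.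
  apply: leeD => //.
  apply: (@le_trans _ _ (\int[mu]_v (g2 v)%:E + \int[mu]_v (g3 v + g4 v)%:E)%E); last first.
    by apply: leeD => //; exact: ge0_le_integral_add.
  exact: ge0_le_integral_add.
apply: ge0_le_integral_add => //.
- by apply: measurable_mulindic => //; exact: measurable_funM.
- by move=> v; rewrite !mulr_ge0// ?tail_ge0.
(* Pointwise majorisation, piece by piece; [g1] lives on the whole half-line and the other pieces
   share endpoints, which is harmless for an upper bound. *)
move=> v; rewrite /dens /g1 /g2 /g3 /g4 !indicE.
have Tv0 := tail_ge0 v. have TA0 := tail_ge0 A.
rewrite !mem_setE !in_itv/= andbT.
case: (leP 0 v) => v0; rewrite ?mulr0 ?mulr1; last first.
  by rewrite add0r; have := p234 v; rewrite /g2 /g3 /g4 !indicE !mem_setE !in_itv/=.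
have Gv0 := G0 (y - v). have GTv := GT (y - v). have GAv := GA (y - v).
have phiv := phi0 (s + v). have phivW := phiW (s + v).
have [vK|vK] := leP v K.
  have := phiK s v0 vK => h.
  have T1' : T (y - v) <= T (y - K) by apply: Tni; lra.
  apply: (@le_trans _ _ ((phi s + e) * T (y - K) * T v)); last first.
    have := p234 v; rewrite /g2 /g3 /g4 !indicE !mem_setE !in_itv/=; lra.
  case: (leP v (y + D)) => _; rewrite ?mulr1 ?mulr0 ?mul0r; last by rewrite !mulr_ge0 ?tail_ge0.
  by apply: ler_wpM2r => //; apply: ler_pM => //; exact: le_trans T1'.
rewrite (ltW vK)/=.
have X1 : 0 <= (phi s + e) * T (y - K) * T v by rewrite !mulr_ge0 ?tail_ge0.
have [vyK|vyK] := leP v (y - K).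
  rewrite mulr1; apply: (@le_trans _ _ (W * (T (y - v) * T v))); last first.
    have := p34 v; rewrite /g3 /g4 !indicE !mem_setE !in_itv/=; lra.
  case: (leP v (y + D)) => _; rewrite ?mulr1 ?mulr0 ?mul0r; last by rewrite !mulr_ge0 ?tail_ge0.
  by rewrite mulrA; apply: ler_wpM2r => //; exact: ler_pM.
rewrite (ltW vyK)/= !mulr0 add0r.
have [vy|vy] := leP v y.
  rewrite mulr1; apply: (@le_trans _ _ (W * T A * T (y - K))); last first.
    have := g40 v; rewrite /g4 !indicE !mem_setE !in_itv/=; lra.
  have T1' : T v <= T (y - K) by apply: Tni; lra.
  case: (leP v (y + D)) => _; rewrite ?mulr1 ?mulr0 ?mul0r; last by rewrite !mulr_ge0 ?tail_ge0.
  by apply: ler_pM => //; [exact: mulr_ge0|exact: ler_pM].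
rewrite (ltW vy)/= mulr0 add0r.
have T1' : T v <= T y by apply: Tni; lra.
have [vD|vD] := leP v (y + D); rewrite ?mulr1 ?mulr0 ?mul0r; last by lra.
apply: (@le_trans _ _ (W * T A * T y)); last by lra.
by apply: ler_pM => //; [exact: mulr_ge0|exact: ler_pM].
Qed.

(** Intended for positions with [y < A]: there the truncated tail has already reached its cap [T A],
    so replacing the density by its maximum [W * T A] loses little. *)
Lemma upward_drift_near s y :
  (\int[mu]_(v in `[0%R, +oo[%classic) (dens s y v * T v)%:E <= (W * T A * a)%:E)%E.
Proof.
have mT := measurable_tail.
have W0' := ltW W0.
rewrite EFinM -Ta -ge0_integralZl_EFin//; last 3 first.
- by move=> x _; rewrite lee_fin tail_ge0.
- by apply/measurable_EFinP; exact: measurable_funTS.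
- by rewrite mulr_ge0// tail_ge0.
apply: ge0_le_integral => //=.
- by move=> v _; rewrite lee_fin mulr_ge0 ?tail_ge0.
- exact: (measurable_EFinM (mdens s y) mT).
- exact: (measurable_EFinM (measurable_cst (W * T A)) mT).
move=> v _; rewrite lee_fin; apply: ler_wpM2r; first exact: tail_ge0.
rewrite /dens indicE.
by case: (_ \in _); rewrite ?mulr0 ?mulr1 ?ler_pM// mulr_ge0// tail_ge0.
Qed.

(** Only downward steps of length at most [K] are kept. Since [y + D] is the distance from [s] to
    the level, its sign ensures that the indicator in [dens] is 1 for all [v < 0]. *)
Lemma downward_drift s y b q : 0 <= b -> 0 <= y + D ->
  (forall v, - K <= v -> v < 0 -> b <= phi (s + v) * G (y - v)) ->
  (q%:E <= \int[mu]_(v in `[(- K)%R, 0%R[%classic) (1 - T v)%:E)%E ->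
  ((b * q)%:E <= \int[mu]_(v in `]-oo, 0%R[%classic) (dens s y v * (1 - T v))%:E)%E.
Proof.
move=> b0 yD bphi qK.
have mT := measurable_tail.
have mT1 : measurable_fun setT (fun v : R => 1 - T v) by exact: measurable_funB.
have T10 v : 0 <= 1 - T v by rewrite subr_ge0.
apply: (@le_trans _ _ (\int[mu]_(v in `[(- K)%R, 0%R[%classic) (b * (1 - T v))%:E)%E).
  under eq_integral do rewrite EFinM.
  rewrite ge0_integralZl_EFin//; last 2 first.
  - by move=> x _; rewrite lee_fin.
  - by apply/measurable_EFinP; exact: measurable_funTS.
  by rewrite EFinM; apply: lee_wpmul2l; rewrite ?lee_fin.
apply: (@le_trans _ _ (\int[mu]_(v in `[(- K)%R, 0%R[%classic) (dens s y v * (1 - T v))%:E)%E).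
  apply: ge0_le_integral => //=.
  - by move=> x _; rewrite lee_fin mulr_ge0.
  - exact: (measurable_EFinM (measurable_cst b) mT1).
  - exact: (measurable_EFinM (mdens s y) mT1).
  move=> v; rewrite in_itv/= => /andP[Kv v0]; rewrite lee_fin; apply: ler_wpM2r => //.
  rewrite /dens indicE mem_setE in_itv/= (le_trans (ltW v0) yD) mulr1.
  exact: bphi.
apply: ge0_subset_integral => //=.
- exact: (measurable_EFinM (mdens s y) mT1).
- by move=> x _; rewrite lee_fin mulr_ge0.
- by move=> v /=; rewrite !in_itv/= => /andP[].
Qed.

End Drift.

(** After translation by [s], the integral of [kappa (s + v) * T v] over [v < 0] occurs on both
    sides. What remains is the gain from upward steps, at most [u], against the loss from downward
    steps, at least [d]. *)
Lemma drift_split (kappa : R -> R) (s u d c : R) :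
  measurable_fun setT kappa -> (forall x, 0 <= kappa x) ->
  (\int[mu]_(v in `[0%R, +oo[%classic) (kappa (s + v) * T v)%:E <= u%:E)%E ->
  (d%:E <= \int[mu]_(v in `]-oo, 0%R[%classic) (kappa (s + v) * (1 - T v))%:E)%E ->
  u <= d + c ->
  (\int[mu]_w (kappa w * T (w - s))%:E <=
   \int[mu]_(w in `]-oo, s[%classic) (kappa w)%:E + c%:E)%E.
Proof.
move=> mk k0 hu hd udc.
have mT := measurable_tail.
have mT1 : measurable_fun setT (fun v : R => 1 - T v) by exact: measurable_funB.
have T10 v : 0 <= 1 - T v by rewrite subr_ge0.
have mks : measurable_fun setT (fun v : R => kappa (s + v)).
  by apply: measurableT_comp => //; exact: measurable_funD.
have mE (f : R -> R) D : measurable_fun setT f -> measurable_fun D (EFin \o f).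
  by move=> mf; apply/measurable_EFinP; exact: measurable_funTS.
have mkT : measurable_fun setT (fun v : R => kappa (s + v) * T v) by exact: measurable_funM.
have mkT1 : measurable_fun setT (fun v : R => kappa (s + v) * (1 - T v)) by exact: measurable_funM.
rewrite (@ge0_integral_translate _ _ s); last 2 first.
- apply: mE; apply: measurable_funM => //; apply: measurableT_comp => //; exact: measurable_funB.
- by move=> x; rewrite lee_fin mulr_ge0// tail_ge0.
rewrite [in leRHS]integral_mulindic (@ge0_integral_translate _ (fun x => (kappa x * _)%:E) s); last 2 first.
- by apply: mE; exact: measurable_mulindic.
- by move=> x; rewrite lee_fin mulr_ge0.
have -> : (\int[mu]_x (kappa (s + x) * \1_(`]-oo, s[%classic) (s + x))%:E =
  \int[mu]_(v in `]-oo, 0%R[%classic) (kappa (s + v))%:E)%E.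
  rewrite [RHS]integral_mulindic; apply: eq_integral => x _.
  by rewrite !indicE !mem_setE !in_itv/= gtrDl.
under eq_integral do rewrite addrAC subrr add0r.
have -> : (\int[mu]_(v in `]-oo, 0%R[%classic) (kappa (s + v))%:E =
  \int[mu]_(v in `]-oo, 0%R[%classic) (kappa (s + v) * T v)%:E +
  \int[mu]_(v in `]-oo, 0%R[%classic) (kappa (s + v) * (1 - T v))%:E)%E.
  rewrite -ge0_integralD//=; last 4 first.
  - by move=> x _; rewrite lee_fin mulr_ge0// tail_ge0.
  - exact: mE.
  - by move=> x _; rewrite lee_fin mulr_ge0.
  - exact: mE.
  by apply: eq_integral => x _; congr (_%:E); ring.
have -> : (\int[mu]_x (kappa (s + x) * T x)%:E =
  \int[mu]_(v in `]-oo, 0%R[%classic) (kappa (s + v) * T v)%:E +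
  \int[mu]_(v in `[0%R, +oo[%classic) (kappa (s + v) * T v)%:E)%E.
  rewrite -ge0_integral_setU//=; last 3 first.
  - exact: mE.
  - by move=> x _; rewrite lee_fin mulr_ge0// tail_ge0.
  - by apply/disj_setPS => x [/=]; rewrite !in_itv/= andbT => /lt_le_trans h /h; rewrite ltxx.
  congr (\int[mu]_(_ in _) _)%E; apply/seteqP; split => // x _ /=.
  by rewrite !in_itv/= andbT; case: (ltP x 0) => _; [left|right].
rewrite -addeA; apply: leeD => //.
apply: (le_trans hu); apply: (@le_trans _ _ (d + c)%:E); first by rewrite lee_fin.
by rewrite EFinD; apply: leeD.
Qed.

Hypothesis Tdrift : (a%:E < \int[mu]_(v in `]-oo, 0%R[%classic) (1 - T v)%:E)%E.

(** [Tdrift] says that the mean negative part exceeds the mean positive part [a]. Exhausting the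
    negative half-line keeps the strict inequality after truncation, with a finite [q]. *)
Lemma lower_tail_integral : exists K0 q : R, [/\ 0 < K0, a < q & forall K, K0 <= K ->
  (q%:E <= \int[mu]_(v in `[(- K)%R, 0%R[%classic) (1 - T v)%:E)%E].
Proof.
have T10 v : 0 <= 1 - T v by rewrite subr_ge0.
have mT1 : measurable_fun setT (fun v : R => (1 - T v)%:E).
  by apply/measurable_EFinP; apply: measurable_funB => //; exact: measurable_tail.
have [|||| K0 [K00 HK0]] := @ge0_integral_exhaust R (fun v => (1 - T v)%:E) `]-oo, 0%R[%classic
  (fun K => `[- K, 0%R[%classic) a mT1 _ _ _ _ Tdrift.
- by move=> x; rewrite lee_fin.
- by move=> K; exact: measurable_itv.
- by move=> x y xy z /=; rewrite !in_itv/= => /andP[? ->]; rewrite andbT; lra.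
- apply/seteqP; split => x /=; rewrite ?in_itv/= => x0.
    exists (Num.truncn (- x)).+1 => //=; rewrite in_itv/= x0 andbT.
    by rewrite lerNl ltW// truncnS_gt.
  by case: x0 => n _ /=; rewrite in_itv/= => /andP[].
have fin : (\int[mu]_(v in `[(- K0)%R, 0%R[%classic) (1 - T v)%:E < +oo)%E.
  apply: (@le_lt_trans _ _ (\int[mu]_(v in `[(- K0)%R, 0%R[%classic) (cst 1%:E) v)%E).
    apply: ge0_le_integral => //=.
    - by move=> x _; rewrite lee_fin.
    - exact: measurable_funTS.
    - by move=> x _; rewrite lee_fin; have := T0 x; lra.
  rewrite integral_cst//= mul1e lebesgue_measure_itv/=.
  by case: ifP => // _; rewrite -EFinB ltry.
have qE : (\int[mu]_(v in `[(- K0)%R, 0%R[%classic) (1 - T v)%:E \is a fin_num)%E.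
  by rewrite ge0_fin_numE//; apply: integral_ge0 => x _; rewrite lee_fin.
exists K0, (fine (\int[mu]_(v in `[(- K0)%R, 0%R[%classic) (1 - T v)%:E)%E).
split => //; first by rewrite -lte_fin fineK// HK0.
move=> K KK0; rewrite fineK//; apply: ge0_subset_integral => //=.
- exact: measurable_funTS.
- by move=> x _; rewrite lee_fin.
- by move=> v /=; rewrite !in_itv/= => /andP[? ->]; rewrite andbT; lra.
Qed.

(** * The ramp and the choice of parameters *)

Let ramp (L u : R) := Num.min 1 (Num.max 0 (u / L)).

Let ramp0 L u : 0 <= ramp L u.
Proof. by rewrite /ramp le_min ler01 le_max lexx. Qed.

Let ramp1 L u : ramp L u <= 1.
Proof. by rewrite /ramp ge_min lexx. Qed.

Let ramp_eq0 L u : 0 < L -> u <= 0 -> ramp L u = 0.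
Proof.
move=> L0 u0; rewrite /ramp max_l ?min_r ?ler01//.
by rewrite pmulr_lle0 ?invr_gt0.
Qed.

Let ramp_eq1 L u : 0 < L -> L <= u -> ramp L u = 1.
Proof.
move=> L0 Lu; rewrite /ramp min_l//.
by rewrite le_max ler_pdivlMr// mul1r Lu orbT.
Qed.

Let ramp_mono L u v : 0 < L -> u <= v -> ramp L u <= ramp L v.
Proof.
move=> L0 uv; apply: le_min2 => //; apply: le_max2 => //.
by rewrite ler_pM2r ?invr_gt0.
Qed.

(** The slope is at most [1 / L]; this is why the ramp will have length [L = K / eta]. *)
Let ramp_lip L eta K u v : 0 < L -> 0 <= v -> v <= K -> K = eta * L ->
  ramp L (u + v) <= ramp L u + eta.
Proof.
move=> L0 v0 vK KE.
have e0 : 0 <= eta by rewrite -(pmulr_lge0 _ L0) -KE; lra.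
have uvL : (u + v) / L <= u / L + eta.
  by rewrite mulrDl lerD2l ler_pdivrMr// -KE.
rewrite /ramp; set t := u / L in uvL *; set t' := (u + v) / L in uvL *.
rewrite ge_min; case: (leP t 0) => t0; last first.
  case: (leP 1 t) => t1; first by rewrite lerDl e0.
  by apply/orP; right; rewrite ge_max; apply/andP; split; lra.
by rewrite (min_r ler01) add0r ge_max e0; apply/orP; right; lra.
Qed.

Let measurable_ramp L : measurable_fun setT (ramp L).
Proof.
apply: measurable_funTS; apply: measurable_minr => //; apply: measurable_maxr => //.
exact: measurable_funM.
Qed.

(** The Lyapunov function is the primitive of [kappa]. By Tonelli the left-hand side of the last
    clause is its expectation one step after [s], so that clause is the drift bound. *)
Lemma lyapunov_density (eps : R) : 0 < eps ->
  \forall x \near +oo, exists kappa : R -> R,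
  [/\ measurable_fun setT kappa, (forall u, 0 <= kappa u),
      (forall u : R, u <= 0 -> kappa u = 0),
      (1 <= \int[mu]_(u in `]-oo, x[%classic) (kappa u)%:E)%E &
      forall s, s <= x -> (\int[mu]_u (kappa u * T (u - s))%:E <=
        \int[mu]_(u in `]-oo, s[%classic) (kappa u)%:E + ((1 + eps) * T x)%:E)%E].
Proof.
move=> eps0.
have a0 : 0 <= a.
  by rewrite -lee_fin -Ta; apply: integral_ge0 => x _; rewrite lee_fin tail_ge0.
have [K1 [q [K10 aq HK1]]] := lower_tail_integral.
have [m' m'0 m'E] : exists2 m', 0 < m' & m' = (q - a) / 2.
  by exists ((q - a) / 2); rewrite // divr_gt0// subr_gt0.
have [eta [eta0 eta1 etam etae]] : exists eta : R, [/\ 0 < eta, eta <= 1,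
    (1 + eta) * (1 + eta) * a + eta + m' <= (1 - eta) * (1 - eta) * q &
    (m' + eta * (4 * a + 1 + 2 * q)) * (1 + eta) <= (1 + eps) * m'].
  exact: drift_constants.
pose eta2 := eta / 2.
have eta20 : 0 < eta2 by rewrite /eta2; lra.
have [K2 [K20 HK2]] := tail_convolution eta20.
pose K := Num.max K1 K2.
have K0 : 0 < K by rewrite /K lt_max K10.
have HKq : (q%:E <= \int[mu]_(v in `[(- K)%R, 0%R[%classic) (1 - T v)%:E)%E.
  by apply: HK1; rewrite /K le_max lexx.
have HKc : \forall y \near +oo,
    (\int[mu]_(v in `[K, (y - K)%R]%classic) (T (y - v) * T v)%:E <= (eta / 2 * T y)%:E)%E.
  by apply: HK2; rewrite /K le_max lexx orbT.
have [M1 [_ HM1]] := HKc.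
have [M2 [_ HM2]] := near_tail_sub K eta0.
have [M3 [_ HM3]] := near_tail_add K eta0 eta1.
(* Above [A] all three asymptotic estimates hold, and [2 * K] puts the cut points [K] and [y - K] in
   order. The last entry, with [T A * A <= a], gives [T A * K <= eta / 4], hence [TAK]. *)
pose A := Num.max (Num.max (M1 + 1) (M2 + 1)) (Num.max (M3 + 1)
  (Num.max (2 * K) (4 * a * K / eta + 1))).
have [A1 A2 A3] : [/\ M1 < A, M2 < A & M3 < A].
  by rewrite /A; split; rewrite !lt_max ltrDl ltr01 ?orbT.
have A4 : 2 * K <= A by rewrite /A !le_max lexx !orbT.
have A5 : 4 * a * K / eta + 1 <= A by rewrite /A !le_max lexx !orbT.
have A0 : 0 < A by lra.
have TAK : T A * K * (1 + eta) <= eta / 2.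
  have TAa := tail_mul_le A0.
  have aKA : 4 * a * K <= eta * A.
    have : 4 * a * K / eta <= A by lra.
    by rewrite ler_pdivrMr// [A * eta]mulrC.
  have TA0 := tail_ge0 A.
  have h1 : T A * K * (1 + eta) <= 2 * (T A * K).
    have : 0 <= T A * K by rewrite mulr_ge0// ltW.
    nra.
  apply: (le_trans h1).
  rewrite -(ler_pM2r A0).
  have h2 : T A * A * K <= a * K by rewrite ler_pM2r.
  lra.
pose L := K / eta.
have L0 : 0 < L by rewrite divr_gt0.
have KE : K = eta * L by rewrite /L mulrC divfK// gt_eqF.
pose W := m'^-1.
have W0 : 0 < W by rewrite invr_gt0.
(* The density equals [T A / m'] on the last stretch of length [D] below the
   level, so this choice of [D] makes the Lyapunov function reach 1. *)
pose D := m' / T A.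
have D0 : 0 < D by rewrite divr_gt0.
have TAD : T A * D = m' by rewrite /D mulrC divfK// gt_eqF.
have Wm : W * m' = 1 by rewrite mulVf// gt_eqF.
pose phi u := W * ramp L u.
have mphi : measurable_fun setT phi by apply: measurable_funM => //; exact: measurable_ramp.
have phi0 u : 0 <= phi u by rewrite mulr_ge0 ?ramp0// ltW.
have phiW u : phi u <= W by rewrite ler_piMr ?ramp1// ltW.
have phiK (u v : R) : 0 <= v -> v <= K -> phi (u + v) <= phi u + W * eta.
  by move=> v0 vK; rewrite -mulrDr ler_pM2l//; apply: ramp_lip vK KE.
have nearx : \forall x \near +oo, T (x - (D + L)) <= (1 + eta) * T x.
  exact: near_tail_sub.
near=> x.
(* Hence the ramp is 1 on the last stretch of length [D], and a position with [y < A] stays on the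
   plateau even after a step down by [K]. *)
have xbig : D + A + K + L < x by near: x; apply: nbhs_pinfty_gt; rewrite num_real.
have Tx : T (x - (D + L)) <= (1 + eta) * T x by near: x.
pose kappa u := phi u * T (Num.max (x - D - u) A) * \1_(`]-oo, x]%classic) u.
have mk : measurable_fun setT kappa.
  apply: measurable_mulindic => //; apply: measurable_funM => //.
  apply: measurableT_comp; first exact: measurable_tail.
  by apply: measurable_maxr => //; exact: measurable_funB.
have k0 u : 0 <= kappa u by apply: mulr_ge0 => //; apply: mulr_ge0; rewrite ?tail_ge0.
exists kappa; split => //.
- by move=> u u0; rewrite /kappa /phi ramp_eq0// mulr0 !mul0r.
- apply: (@le_trans _ _ (\int[mu]_(u in `[(x - D)%R, x[%classic) (W * T A)%:E)%E).
    rewrite integral_cst//= lebesgue_measure_itv/= lte_fin ltrBlDr ltrDl D0.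
    by rewrite -EFinB -EFinM lee_fin opprB addrCA subrr addr0 -mulrA TAD Wm.
  apply: (@le_trans _ _ (\int[mu]_(u in `[(x - D)%R, x[%classic) (kappa u)%:E)%E).
    apply: ge0_le_integral => //=.
    + by move=> u _; rewrite lee_fin mulr_ge0 ?tail_ge0// ltW.
    + by apply/measurable_EFinP; exact: measurable_funTS.
    + move=> u; rewrite in_itv/= => /andP[ux1 ux2]; rewrite lee_fin /kappa.
      rewrite indicE mem_setE in_itv/= (ltW ux2) mulr1 /phi ramp_eq1//; last by lra.
      by rewrite mulr1 max_r//; lra.
  apply: ge0_subset_integral => //=.
  + by apply/measurable_EFinP; exact: measurable_funTS.
  + by move=> u _; rewrite lee_fin.
  + by move=> u /=; rewrite !in_itv/= => /andP[].
move=> s sx.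
pose y := x - D - s.
have yD : 0 <= y + D by rewrite /y addrAC subrK subr_ge0.
have kE v : kappa (s + v) = phi (s + v) * T (Num.max (y - v) A) * \1_(`]-oo, y + D]%classic) v.
  rewrite /kappa; congr (_ * T (Num.max _ _) * _); first by rewrite /y opprD addrA.
  by rewrite !indicE !mem_setE !in_itv/= /y addrAC subrK lerBrDl.
have sV v : s = (s + v) + - v by rewrite addrK.
(* Close to the level, all densities involved are near [W * T A], and [a <= (1 - eta) * q] makes the
   drift nonpositive. *)
case: (ltP y A) => [yA|Ay].
  have sL : L + K <= s by move: yA xbig; rewrite /y; lra.
  apply: (drift_split (u := W * T A * a) (d := W * ((1 - eta) * T A) * q)) => //.
  - under eq_integral do rewrite kE.
    exact: (upward_drift_near A D mphi phi0 phiW W0 s y).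
  - under eq_integral do rewrite kE.
    apply: (downward_drift (K := K) mphi phi0 _ yD _ HKq).
      by rewrite mulr_ge0 ?(ltW W0)// mulr_ge0 ?tail_ge0 ?subr_ge0.
    move=> v Kv v0; rewrite /phi ramp_eq1//; last first.
      by apply: (le_trans (_ : L <= s - K)); rewrite ?lerBrDr// lerD2l.
    rewrite mulr1 ler_pM2l//; apply: (@le_trans _ _ (T (A + K))); first exact: HM3.
    by apply: Tni; rewrite ge_max lerD ?lerDl ?(ltW K0) ?(ltW yA)// lerNl.
  - have aq' : a <= (1 - eta) * q by nra.
    have := ler_wpM2l (mulr_ge0 (ltW W0) (tail_ge0 A)) aq'.
    have := mulr_ge0 (addr_ge0 ler01 (ltW eps0)) (tail_ge0 x).
    lra.
pose p := ramp L s.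
have p0 : 0 <= p := ramp0 L s.
have p1 : p <= 1 := ramp1 L s.
have Ty0 := tail_ge0 y.
pose u := ((phi s + W * eta) * (1 + eta) * a + W * (eta + T A * D)) * T y.
pose d := Num.max 0 (phi s - W * eta) * ((1 - eta) * T y) * q.
apply: (drift_split (u := u) (d := d)) => //.
- under eq_integral do rewrite kE.
  apply: (upward_drift_far mphi phi0 phiW phiK K0 D0 A4 eta0 W0 s Ay _ _ TAK).
  + by apply: HM2; exact: lt_le_trans Ay.
  + by apply: HM1; exact: lt_le_trans Ay.
- under eq_integral do rewrite kE.
  apply: (downward_drift (K := K) mphi phi0 _ yD _ HKq).
    by rewrite mulr_ge0 ?le_max ?lexx// mulr_ge0 ?tail_ge0 ?subr_ge0.
  move=> v Kv v0; apply: ler_pM.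
  + by rewrite le_max lexx.
  + by rewrite mulr_ge0 ?tail_ge0 ?subr_ge0.
  (* The growth bound on the ramp is applied from [s + v] up to [s]. *)
  + rewrite ge_max phi0/= lerBlDr {1}(sV v); apply: phiK; [rewrite oppr_ge0 ltW//|rewrite lerNl//].
  + apply: (@le_trans _ _ (T (y + K))); first by apply: HM3; exact: lt_le_trans Ay.
    by apply: Tni; rewrite ge_max lerD2l lerNl Kv (le_trans Ay)// lerDl ltW.
(* The net drift with [W * T y] factored out; the summand [m'] is [T A * D], the cost of the last
   stretch. *)
pose B := (p + eta) * (1 + eta) * a + eta + m' - Num.max 0 (p - eta) * (1 - eta) * q.
have udB : u - d = W * B * T y.
  have maxW : Num.max 0 (phi s - W * eta) = W * Num.max 0 (p - eta).
    by rewrite /phi -mulrBr maxr_pMr ?mulr0// ltW.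
  by rewrite /u /d maxW TAD /B /phi -/p; ring.
rewrite -lerBlDl udB.
(* Only below [L] may the drift be positive. There [y > x - D - L], so long-tailedness compares
   [T y] with [T x]; on the plateau [p = 1] and the choice of [eta] gives [B <= 0]. *)
case: (ltP s L) => [sL|Ls].
  have BB : B <= m' + eta * (4 * a + 1 + 2 * q).
    apply: (drift_bracket a0 aq (ltW m'0) eta0 eta1 p0 p1 etam).
  have Tyx : T y <= (1 + eta) * T x.
    by apply: le_trans Tx; apply: Tni; rewrite /y opprD addrA lerD2l lerN2 ltW.
  have Tx0 := tail_ge0 x.
  have BB0 : 0 <= m' + eta * (4 * a + 1 + 2 * q).
    by rewrite addr_ge0 ?(ltW m'0)// mulr_ge0 ?(ltW eta0)//; lra.
  rewrite -mulrA -(ler_pM2l m'0) [m' * (W * _)]mulrA [m' * W]mulrC Wm mul1r.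
  apply: (@le_trans _ _ ((m' + eta * (4 * a + 1 + 2 * q)) * T y)).
    by apply: ler_wpM2r.
  apply: (le_trans (ler_wpM2l BB0 Tyx)).
  rewrite mulrA; apply: (le_trans (ler_wpM2r Tx0 etae)); lra.
have pE : p = 1 by rewrite /p ramp_eq1.
have B0 : B <= 0 by rewrite /B pE max_r ?subr_ge0// subr_le0.
apply: (@le_trans _ _ 0); last by rewrite mulr_ge0 ?tail_ge0// addr_ge0 ?ler01 ?ltW.
by rewrite mulr_le0_ge0 ?tail_ge0// mulr_ge0_le0// ltW.
Unshelve. all: by end_near. Qed.

End Tail.

(** * Independence and the Lyapunov function *)

Section Independence.
Context {R : realType} {d d' : measure_display} {Omega : measurableType d}
  {Y : measurableType d'}.
Variables (P : probability Omega R) (phi : Omega -> Y) (X : Omega -> R).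
Hypotheses (mphi : measurable_fun setT phi) (mX : measurable_fun setT X).
Hypothesis indep : forall B C, measurable B -> measurable C ->
  (P (phi @^-1` B `&` X @^-1` C) = P (phi @^-1` B) * P (X @^-1` C))%E.

(** Independence identifies the joint law of [(phi, X)] with the product of the marginal laws on
    rectangles, hence everywhere, and Tonelli applies. The target of [phi] is arbitrary so that
    [phi] can stand for the whole past. *)
Lemma indep_integral (f : Y * R -> \bar R) :
  measurable_fun setT f -> (forall z, 0 <= f z)%E ->
  (\int[P]_w f (phi w, X w) = \int[P]_w \int[P]_w' f (phi w, X w'))%E.
Proof.
move=> mf f0.
pose phiM : {mfun Omega >-> Y} := HB.pack phi (isMeasurableFun.Build _ _ _ _ phi mphi).
pose XM : {mfun Omega >-> R} := HB.pack X (isMeasurableFun.Build _ _ _ _ X mX).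
pose phiX : Omega -> Y * R := fun w => (phi w, X w).
have mphiX : measurable_fun setT phiX by exact: measurable_fun_pair.
pose phiXM : {mfun Omega >-> (Y * R)%type} :=
  HB.pack phiX (isMeasurableFun.Build _ _ _ _ phiX mphiX).
have prodE A : measurable A ->
    (distribution P phiM \x distribution P XM)%E A = distribution P phiXM A.
  apply: product_measure_unique => B C mB mC.
  exact: indep.
have mfs y : measurable_fun setT (fun t => f (y, t)).
  by apply: measurableT_comp => //; exact: pair1_measurable.
have F0 y : (0 <= fubini_F (distribution P XM) f y)%E by exact: integral_ge0.
transitivity (\int[distribution P phiXM]_z f z)%E.
  by rewrite ge0_integral_pushforward// preimage_setT.
transitivity (\int[(distribution P phiM \x distribution P XM)%E]_z f z)%E.
  by apply: eq_measure_integral => A mA _; apply/esym; exact: prodE.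
rewrite fubini_tonelli1// ge0_integral_pushforward//; last first.
  exact: measurable_fun_fubini_tonelli_F.
rewrite preimage_setT; apply: eq_integral => w _.
by rewrite /= /fubini_F ge0_integral_pushforward// preimage_setT.
Qed.

End Independence.

(** * The Lyapunov function as the primitive of its density *)

Section Primitive.
Context {R : realType}.
Variable kappa : R -> R.
Hypotheses (mk : measurable_fun setT kappa) (k0 : forall u, 0 <= kappa u).

Definition primitive (t : R) : \bar R :=
  (\int[lebesgue_measure]_(u in `]-oo, t[%classic) (kappa u)%:E)%E.

Lemma primitive_ge0 t : (0 <= primitive t)%E.
Proof. by apply: integral_ge0 => u _; rewrite lee_fin. Qed.

Lemma le_primitive : {homo primitive : s t / s <= t >-> (s <= t)%E}.
Proof.
move=> s t st; apply: ge0_subset_integral => //.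
- by apply/measurable_EFinP; exact: measurable_funTS.
- by move=> u _; rewrite lee_fin.
- by move=> u /=; rewrite !in_itv/= => /lt_le_trans; apply.
Qed.

Let below : set (R * measurableTypeR R) := [set z | z.2 < z.1].

Let measurable_below : measurable below.
Proof.
have -> : below = (fun z : R * measurableTypeR R => z.1 - z.2) @^-1` `]0, +oo[%classic.
  by apply/seteqP; split => z /=; rewrite /below in_itv/= andbT subr_gt0.
rewrite -[X in measurable X]setTI.
have : measurable_fun setT (fun z : R * measurableTypeR R => z.1 - z.2).
  by apply: measurable_funB.
by apply => //; exact: measurable_itv.
Qed.

Let density (z : R * measurableTypeR R) : \bar R := (kappa z.2 * \1_below z)%:E.

Let measurable_density : measurable_fun setT density.
Proof.
apply/measurable_EFinP; apply: measurable_funM; first by apply: measurableT_comp.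
exact/measurable_indicP.
Qed.

Let primitiveE t : primitive t = (\int[lebesgue_measure]_u density (t, u))%E.
Proof.
rewrite /primitive integral_mulindic; apply: eq_integral => u _.
by rewrite /density !indicE !mem_setE in_itv/=.
Qed.

Lemma measurable_primitive : measurable_fun setT primitive.
Proof.
have -> : primitive = fubini_F lebesgue_measure density.
  by apply/funext => t; rewrite primitiveE.
apply: measurable_fun_fubini_tonelli_F => //.
by move=> z; rewrite lee_fin mulr_ge0.
Qed.

(** Tonelli: for fixed [u], the point [u] lies below [s + X] with probability [T (u - s)]. *)
Lemma integral_primitive_translate {d} {Omega : measurableType d}
    (P : probability Omega R) (X : Omega -> R) (s : R) (T : R -> R) :
  measurable_fun setT X -> (forall t, P [set w | t < X w] = (T t)%:E) ->
  (\int[P]_w primitive (s + X w) =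
   \int[lebesgue_measure]_u (kappa u * T (u - s))%:E)%E.
Proof.
move=> mX XT.
under eq_integral do rewrite primitiveE.
pose f (z : Omega * measurableTypeR R) := density (s + X z.1, z.2).
have mg : measurable_fun setT (fun z : Omega * measurableTypeR R => (s + X z.1, z.2) : R * measurableTypeR R).
  apply: measurable_fun_pair => //; apply: measurable_funD => //.
  exact: measurableT_comp.
rewrite (@fubini_tonelli _ _ _ _ _ P lebesgue_measure f); last 2 first.
- exact: measurableT_comp.
- by move=> z; rewrite lee_fin mulr_ge0.
apply: eq_integral => u _.
rewrite /f /density /=.
under eq_integral do rewrite EFinM.
have mE : measurable [set w | u - s < X w].
  have -> : [set w | u - s < X w] = X @^-1` `]u - s, +oo[%classic.
    by apply/seteqP; split => w /=; rewrite in_itv/= andbT.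
  by rewrite -[X in measurable X]setTI; apply: mX.
have indE w : \1_below (s + X w, u) = \1_[set w | u - s < X w] w :> R.
  by rewrite !indicE; congr ((_ : bool)%:R); apply/idP/idP; rewrite !inE/= /below/= ltrBlDl.
under eq_integral do rewrite indE.
rewrite ge0_integralZl_EFin//; last by apply/measurable_EFinP; exact/measurable_indicP.
by rewrite integral_indic// setIT EFinM; congr (_ * _)%E; exact: XT.
Qed.

End Primitive.

(** * Optional stopping and the one big jump *)

Section Stopping.
Context {R : realType} {d : measure_display} {Omega : measurableType d}.
Variables (P : probability Omega R) (xi : nat -> Omega -> R)
  (Fil : nat -> set (set Omega)) (sigma : Omega -> option nat).
Hypotheses (mxi : forall n, (0 < n)%N -> measurable_fun setT (xi n))
  (filtration : admissible_filtration P xi Fil) (stopping : stopping_time Fil sigma).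

Let Sn := S xi.

(** The event [sigma >= n], including [sigma = None]. *)
Definition not_stopped (n : nat) : set Omega := [set w | forall k, (k < n)%N -> sigma w <> Some k].

Definition reaches (x : R) (n : nat) : set Omega :=
  not_stopped n `&` [set w | forall i, (i < n)%N -> Sn i w <= x].

(** The first passage above [x] occurs at time [n], and [n <= sigma]. *)
Definition crosses (x : R) (n : nat) : set Omega := reaches x n `&` [set w | x < Sn n w].

Let sumS n w : Sn n.+1 w = Sn n w + xi n.+1 w.
Proof. by rewrite /Sn /S big_nat_recr. Qed.

Let Fil_sigma n : sigma_algebra setT (Fil n). Proof. by case: filtration. Qed.

Let Fil_measurable n : Fil n `<=` measurable. Proof. by case: filtration => _ []. Qed.

Let Fil_mono n m : (n <= m)%N -> Fil n `<=` Fil m.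
Proof. by case: filtration => _ [_ [h _]]; exact: h. Qed.

(** [Omega] carrying only the information up to time [n], so that adaptedness becomes ordinary
    measurability. *)
Let Fil_type n := g_sigma_algebraType (Fil n).

Let measurable_FilE n (A : set Omega) : measurable (A : set (Fil_type n)) = Fil n A.
Proof. by rewrite /measurable/= sigma_algebra_id. Qed.

Let measurable_Fil n (A : set Omega) : Fil n A -> measurable (A : set (Fil_type n)).
Proof. by rewrite measurable_FilE. Qed.

Let measurable_id_Fil n : measurable_fun setT (id : Omega -> Fil_type n).
Proof.
move=> _ B; rewrite setTI => mB; apply: (@Fil_measurable n).
by rewrite -measurable_FilE.
Qed.

Let measurable_xi_Fil n i : (0 < i)%N -> (i <= n)%N -> measurable_fun setT (xi i : Fil_type n -> R).
Proof.
move=> i0 i_n _ B mB; rewrite setTI; apply: measurable_Fil.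
by apply: (Fil_mono i_n); case: filtration => _ [_ [_ [h _]]]; exact: h.
Qed.

Let measurable_S_Fil n i : (i <= n)%N -> measurable_fun setT (Sn i : Fil_type n -> R).
Proof.
elim: i => [_|i IH i_n].
  by rewrite (_ : Sn 0%N = cst 0)//; apply/funext => w; rewrite /Sn /S big_geq.
rewrite (_ : Sn i.+1 = fun w => Sn i w + xi i.+1 w); last by apply/funext => w; rewrite sumS.
by apply: measurable_funD; [exact: (IH (ltnW i_n))|exact: measurable_xi_Fil].
Qed.

Let measurable_S n : measurable_fun setT (Sn n).
Proof.
have := measurable_S_Fil (leqnn n) => h _ B mB.
by apply: (@Fil_measurable n); rewrite -measurable_FilE; exact: (h measurableT B mB).
Qed.

(** Only the events [sigma = k] with [k < n] enter, so time [n - 1] suffices. This shift makes the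
    event independent of step [n]. *)
Lemma Fil_not_stopped n m : (n <= m.+1)%N -> Fil m (not_stopped n).
Proof.
move=> nm; rewrite -measurable_FilE.
have -> : not_stopped n = \bigcap_(k in [set k | (k < n)%N]) ~` [set w | sigma w = Some k].
  by apply/seteqP; split => w /= h k /h.
apply: bigcap_measurableType => k kn; apply: measurableC.
by apply: measurable_Fil; apply: (Fil_mono _ (stopping k)); rewrite -ltnS (leq_trans kn).
Qed.

Lemma Fil_S_le n i x : (i <= n)%N -> Fil n [set w | Sn i w <= x].
Proof.
move=> i_n; rewrite -measurable_FilE.
have -> : [set w | Sn i w <= x] = [set: Fil_type n] `&` Sn i @^-1` `]-oo, x]%classic.
  by rewrite setTI; apply/seteqP; split => w /=; rewrite in_itv.
exact: measurable_S_Fil.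
Qed.

Lemma Fil_S_gt n i x : (i <= n)%N -> Fil n [set w | x < Sn i w].
Proof.
move=> i_n; rewrite -measurable_FilE.
have -> : [set w | x < Sn i w] = ~` [set w | Sn i w <= x].
  by apply/seteqP; split => w /=; rewrite ltNge => /negP.
by apply: measurableC; apply: measurable_Fil; exact: Fil_S_le.
Qed.

Lemma Fil_reaches x n m : (n <= m.+1)%N -> Fil m (reaches x n).
Proof.
move=> nm; rewrite -measurable_FilE; apply: measurableI.
  by apply: measurable_Fil; exact: Fil_not_stopped.
rewrite (_ : [set _ | _] = \bigcap_(i in [set i | (i < n)%N]) [set w | Sn i w <= x])//.
apply: bigcap_measurableType => i /= i_n.
by apply: measurable_Fil; apply: Fil_S_le; rewrite -ltnS (leq_trans i_n).
Qed.

Let measurable_not_stopped n : measurable (not_stopped n).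
Proof. exact/Fil_measurable/(@Fil_not_stopped n n). Qed.

Let measurable_reaches x n : measurable (reaches x n).
Proof. exact/Fil_measurable/(@Fil_reaches x n n). Qed.

Let measurable_crosses x n : measurable (crosses x n).
Proof. by apply: measurableI => //; apply: (@Fil_measurable n); exact: Fil_S_gt. Qed.

(** If the supremum exceeds [x], some partial sum does; the least such index is the first passage
    time, and first passages at different times are disjoint. *)
Lemma probability_M_st x :
  P [set w | (x%:E < M_st xi sigma w)%E] = (\sum_(0 <= n <oo) P (crosses x n))%E.
Proof.
have -> : [set w | (x%:E < M_st xi sigma w)%E] = \bigcup_n crosses x n.
  apply/seteqP; split => w /=.
    move=> /ereal_sup_gt[_ [i /= iw <-]]; rewrite lte_fin => xi_.
    have ex : exists i, x < Sn i w by exists i.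
    case: (ex_minnP ex) => n xn nmin.
    have ni : (n <= i)%N := nmin i xi_.
    exists n => //; split => //; split => /=.
      move=> k kn sk; move: iw; rewrite sk/= leqNgt => /negP; apply.
      exact: leq_trans ni.
    by move=> k kn; rewrite leNgt; apply/negP => /nmin; rewrite leqNgt kn.
  move=> [n _ [[nst _] xn]]; apply: (@lt_le_trans _ _ (Sn n w)%:E).
    by rewrite lte_fin.
  apply: ereal_sup_ubound; exists n => //=.
  rewrite /le_st; case E : (sigma w) => [k|//]; rewrite leqNgt; apply/negP => kn.
  exact: (nst k kn).
rewrite measure_bigcup//.
  by apply: eq_eseriesl => n; rewrite in_setT.
apply/trivIsetP => i j _ _ ij; rewrite -subset0 => w [[[_ hi] xi_] [[_ hj] xj]].
move: ij; rewrite neq_ltn => /orP[/hj|/hi]/=; rewrite leNgt => /negP; apply; [exact: xi_|exact: xj].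
Qed.

(** Tail-sum formula: [sigma] counts the [n] with [sigma > n], infinitely many for [None], and the
    series is integrated termwise. *)
Lemma E_stE : E_st P sigma = (\sum_(0 <= n <oo) P (not_stopped n.+1))%E.
Proof.
rewrite /E_st.
have partial_sum w m : (forall k, (k < m)%N -> not_stopped k.+1 w) ->
    (\sum_(0 <= n < m) (\1_(not_stopped n.+1) w)%:E = (m%:R : R)%:E)%E.
  move=> h; rewrite (eq_big_nat _ _ (F2 := fun=> (1 : R)%:E)) => [|k /andP[_ km]].
    by rewrite sumEFin sumr_const_nat subn0.
  by rewrite indicE mem_set//; exact: h.
transitivity (\int[P]_w \sum_(0 <= n <oo) (\1_(not_stopped n.+1) w)%:E)%E.
  apply: eq_integral => w _; rewrite /st_ext.
  case E : (sigma w) => [m|].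
    rewrite (nneseries_split 0 m) ?add0n => [|k _]; last by rewrite lee_fin.
    rewrite eseries0 ?adde0 => [|k mk _]; last first.
      rewrite indicE memNset//= => h; exact: (h m _ E).
    by rewrite partial_sum ?subn0// => k km i ik; rewrite E => -[mi]; move: ik; rewrite -mi ltnS leqNgt km.
  apply/esym/eqyP => A A0.
  apply: (@le_trans _ _ (\sum_(0 <= n < (Num.truncn A).+1) (\1_(not_stopped n.+1) w)%:E)%E).
    rewrite partial_sum => [|k _ i _]; last by rewrite E.
    by rewrite lee_fin ltW// truncnS_gt.
  by apply: nneseries_lim_ge => n _ _; rewrite lee_fin.
rewrite integral_nneseries//; last by move=> n; apply/measurable_EFinP; exact/measurable_indicP.
by apply: eq_eseriesr => n _; rewrite integral_indic// setIT.
Qed.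

Let integral_indicM (A : set Omega) (g : Omega -> \bar R) :
  (\int[P]_(w in A) g w = \int[P]_w ((\1_A w)%:E * g w))%E.
Proof.
rewrite integral_mkcond; apply: eq_integral => w _.
by rewrite patchE indicE; case: ifP => _; rewrite ?mul1e ?mul0e.
Qed.

(* The identity from [Omega] to [Omega] equipped with the sigma-algebra [Fil n]
   plays the role of the past, which is independent of the next step. *)
Lemma integral_next_step n A (f : R -> \bar R) : Fil n A ->
  measurable_fun setT f -> (forall s, 0 <= f s)%E ->
  (\int[P]_(w in A) f (Sn n.+1 w) =
   \int[P]_(w in A) \int[P]_w' f (Sn n w + xi n.+1 w')%R)%E.
Proof.
move=> FA mf f0.
pose A' : set (Fil_type n) := A.
have mA' : measurable A' by exact: measurable_Fil.
pose F (z : Fil_type n * R) : \bar R := ((\1_A' z.1)%:E * f (Sn n z.1 + z.2)%R)%E.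
have mI : measurable_fun setT (\1_A' : Fil_type n -> R) by exact: measurable_indic.
have mSn : measurable_fun setT (fun z : Fil_type n * R => Sn n z.1 + z.2).
  apply: measurable_funD => //; apply: measurableT_comp => //.
  exact: measurable_S_Fil.
have mF : measurable_fun setT F.
  apply: emeasurable_funM; last exact: measurableT_comp.
  by apply/measurable_EFinP; exact: (measurableT_comp mI).
have F0 z : (0 <= F z)%E by rewrite mule_ge0// lee_fin.
have indep B C : measurable (B : set (Fil_type n)) -> measurable C ->
    (P (id @^-1` B `&` xi n.+1 @^-1` C) = P (id @^-1` B) * P (xi n.+1 @^-1` C))%E.
  rewrite measurable_FilE => FB mC.
  by case: filtration => _ [_ [_ [_ h]]]; exact: h.
have := indep_integral (@measurable_id_Fil n) (mxi (ltn0Sn n)) indep mF F0.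
rewrite !(integral_indicM A).
under eq_integral do rewrite /F/= -sumS.
move=> ->; apply: eq_integral => w _.
rewrite /F/= ge0_integralZl_EFin//.
by apply: measurableT_comp => //; apply: measurable_funD => //; exact: mxi.
Qed.

Let reachesS x n : reaches x n.+1 =
  reaches x n `&` ([set w | Sn n w <= x] `&` ~` [set w | sigma w = Some n]).
Proof.
apply/seteqP; split => w /=.
  move=> [ns le]; split; first split => [k kn|i i_n]; [exact/ns/ltnW|exact/le/ltnW|].
  by split => /=; [exact: le|exact: ns].
move=> [[ns le] [xn sn]]; split => [k|i] /=; rewrite ltnS leq_eqVlt => /orP[/eqP ->//|].
  exact: ns.
exact: le.
Qed.

(** Within [reaches x n], paths crossing at time [n] have [h >= 1], which pays for their
    probability. Paths that continue below the level pay at most [c] for the next step. Those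
    stopped below the level are dropped, as [h >= 0]. *)
Lemma lyapunov_step (h : R -> \bar R) (x c : R) n :
  measurable_fun setT h -> (forall s, 0 <= h s)%E -> 0 <= c ->
  (forall s, x < s -> (1 <= h s)%E) ->
  (forall s, s <= x -> (\int[P]_w h (s + xi n.+1 w)%R <= h s + c%:E)%E) ->
  (\int[P]_(w in reaches x n.+1) h (Sn n.+1 w) + P (crosses x n) <=
   \int[P]_(w in reaches x n) h (Sn n w) + c%:E * P (not_stopped n.+1))%E.
Proof.
move=> mh h0 c0 h1 hstep.
have mhS : measurable_fun setT (fun w => h (Sn n w)) by exact: measurableT_comp.
have mnext : measurable_fun setT (fun w => \int[P]_w' h (Sn n w + xi n.+1 w')%R)%E.
  pose f (z : Omega * Omega) := h (Sn n z.1 + xi n.+1 z.2).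
  apply: (@measurable_fun_fubini_tonelli_F _ _ _ _ _ P f); last by move=> z; exact: h0.
  apply: measurableT_comp => //; apply: measurable_funD; apply: measurableT_comp => //.
  exact: mxi.
rewrite (integral_next_step (@Fil_reaches x n.+1 n (leqnn _)) mh h0).
have le1 : (\int[P]_(w in reaches x n.+1) \int[P]_w' h (Sn n w + xi n.+1 w')%R <=
    \int[P]_(w in reaches x n.+1) h (Sn n w) + c%:E * P (not_stopped n.+1))%E.
  apply: (@le_trans _ _ (\int[P]_(w in reaches x n.+1) (h (Sn n w) + c%:E))%E).
    apply: ge0_le_integral => //.
    - by move=> w _; exact: integral_ge0.
    - exact: measurable_funTS.
    - by apply: emeasurable_funD => //; exact: measurable_funTS.
    - by move=> w [_ /= le]; apply: hstep; exact: le.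
  rewrite ge0_integralD//; last exact: measurable_funTS.
  apply: leeD => //; rewrite (@integral_cst _ _ _ P _ _ c%:E)//.
  by apply: lee_wpmul2l; rewrite ?lee_fin// le_measure ?inE// => w [].
have le2 : (P (crosses x n) <= \int[P]_(w in crosses x n) h (Sn n w))%E.
  rewrite -[leLHS]mul1e -(integral_cst P (measurable_crosses x n) 1%E).
  apply: ge0_le_integral => //; first exact: measurable_funTS.
  by move=> w [_ /= xn]; exact: h1.
apply: (le_trans (leeD le1 le2)).
rewrite addeAC; apply: leeD => //.
rewrite -ge0_integral_setU//; last 2 first.
- exact: measurable_funTS.
- apply/disj_setPS => w [[_ le] [_ /= xn]].
  by have /= := le n (ltnSn n); rewrite leNgt xn.
apply: ge0_subset_integral => //; [exact: measurableU|exact: measurable_funTS|].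
by move=> w [|[]//]; rewrite reachesS => -[].
Qed.

(** The one-step inequalities are summed up to a finite [N], starting from [h 0 = 0]; the remaining
    integral of [h] is nonnegative and is discarded before [N] tends to infinity. *)
Lemma lyapunov_crossing (h : R -> \bar R) (x c : R) :
  measurable_fun setT h -> (forall s, 0 <= h s)%E -> h 0 = 0%E -> 0 <= c ->
  (forall s, x < s -> (1 <= h s)%E) ->
  (forall n s, s <= x -> (\int[P]_w h (s + xi n.+1 w)%R <= h s + c%:E)%E) ->
  (P [set w | (x%:E < M_st xi sigma w)%E] <= c%:E * E_st P sigma)%E.
Proof.
move=> mh h0 h00 c0 h1 hstep.
rewrite probability_M_st E_stE -nneseriesZl//.
have partial N : (\int[P]_(w in reaches x N) h (Sn N w) + \sum_(0 <= n < N) P (crosses x n) <=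
    \sum_(0 <= n < N) c%:E * P (not_stopped n.+1))%E.
  elim: N => [|N IH].
    rewrite !big_geq// adde0 (_ : Sn 0%N = cst 0); last first.
      by apply/funext => w; rewrite /Sn /S big_geq.
    by rewrite /= h00 integral0.
  rewrite !big_nat_recr//= addeCA.
  apply: (@le_trans _ _ (\sum_(0 <= n < N) P (crosses x n) +
    (\int[P]_(w in reaches x N) h (Sn N w) + c%:E * P (not_stopped N.+1)))%E).
    by apply: leeD => //; exact: (lyapunov_step mh h0 c0 h1 (hstep N)).
  by rewrite addeA; apply: leeD => //; rewrite addeC.
apply: lime_le; first by apply: is_cvg_nneseries => n _ _; exact: measure_ge0.
near=> N.
apply: (@le_trans _ _ (\sum_(0 <= n < N) c%:E * P (not_stopped n.+1))%E).
  apply: le_trans (partial N); rewrite leeDr//.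
  by apply: integral_ge0.
by apply: nneseries_lim_ge => n _ _; rewrite mule_ge0.
Unshelve. all: by end_near. Qed.

(* The past up to time [n] stays in a bounded region, so that a single jump
   larger than [x + j] at time [n + 1] crosses [x]. *)
Definition quiet (j : R) (n : nat) : set Omega :=
  not_stopped n.+1 `&` ([set w | forall i, (i <= n)%N -> Sn i w <= j] `&`
    [set w | - j <= Sn n w]).

Let Fil_quiet j n : Fil n (quiet j n).
Proof.
rewrite -measurable_FilE; apply: measurableI.
  by apply: measurable_Fil; exact: Fil_not_stopped.
apply: measurableI.
  rewrite (_ : [set _ | _] = \bigcap_(i in [set i | (i <= n)%N]) [set w | Sn i w <= j])//.
  apply: bigcap_measurableType => i /= i_n.
  by apply: measurable_Fil; exact: Fil_S_le.
have -> : [set w | - j <= Sn n w] = [set: Fil_type n] `&` Sn n @^-1` `[- j, +oo[%classic.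
  by rewrite setTI; apply/seteqP; split => w /=; rewrite in_itv/= andbT.
exact: measurable_S_Fil.
Qed.

Lemma measurable_quiet j n : measurable (quiet j n).
Proof. exact: (@Fil_measurable n). Qed.

(** [quiet j n] belongs to the past, hence is independent of the next jump. A jump above [x + j]
    from a position at least [- j] makes the first passage at time [n + 1], and these events are
    disjoint. *)
Lemma one_big_jump (T : R -> R) (N : nat) (j x : R) : j <= x ->
  (forall n t, P [set w | t < xi n.+1 w] = (T t)%:E) ->
  (\sum_(0 <= n < N) P (quiet j n) * (T (x + j))%:E <=
   P [set w | (x%:E < M_st xi sigma w)%E])%E.
Proof.
move=> jx xiT.
apply: (@le_trans _ _ (\sum_(0 <= n < N.+1) P (crosses x n))%E); last first.
  rewrite probability_M_st; apply: nneseries_lim_ge => n _ _; exact: measure_ge0.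
(* The jump after time [n] crosses at time [n + 1], so the term for time 0 is discarded. *)
rewrite big_nat_recl//; apply: (@le_trans _ _ (\sum_(0 <= n < N) P (crosses x n.+1))%E); last first.
  by rewrite leeDr// measure_ge0.
apply: lee_sum => n _.
have jumpE : [set w | x + j < xi n.+1 w] = xi n.+1 @^-1` `]x + j, +oo[%classic.
  by apply/seteqP; split => w /=; rewrite in_itv/= andbT.
rewrite -(xiT n) jumpE.
case: filtration => _ [_ [_ [_ <-]]]//.
have mjump : measurable (xi n.+1 @^-1` `]x + j, +oo[%classic).
  by rewrite -[X in measurable X]setTI; exact: mxi.
apply: le_measure; rewrite ?inE//.
  by apply: measurableI => //; exact: measurable_quiet.
move=> w /= [[ns [le ge]]]; rewrite in_itv/= andbT => xj.
split; first split => //.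
  by move=> i /=; rewrite ltnS => i_n; apply: le_trans jx; exact: le.
rewrite /= sumS; move: ge => /=; lra.
Qed.

Lemma cvg_quiet n : P (quiet j%:R n) @[j --> \oo] --> P (not_stopped n.+1).
Proof.
have -> : not_stopped n.+1 = \bigcup_j quiet j%:R n.
  apply/seteqP; split => w /=; last by move=> [j _ []].
  move=> ns.
  (* The sum of the absolute values bounds each of the finitely many positions. *)
  exists (Num.truncn (\sum_(0 <= i < n.+1) `|Sn i w|)).+1 => //; split => //.
  have le i : (i <= n)%N -> `|Sn i w| <= (Num.truncn (\sum_(0 <= i < n.+1) `|Sn i w|)).+1%:R.
    move=> i_n; apply/ltW/(le_lt_trans _ (truncnS_gt _)).
    rewrite (bigD1_seq i) ?mem_index_iota ?iota_uniq//= lerDl.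
    by apply: sumr_ge0.
  split => /= [i /le|]; first exact/le_trans/ler_norm.
  by have := le n (leqnn n); rewrite ler_norml => /andP[].
have mq j : measurable (quiet j%:R n) := measurable_quiet j%:R n.
apply: nondecreasing_cvg_mu => //.
  by apply: bigcupT_measurable.
move=> i j ij; apply/subsetPset => w [ns [le ge]]; split => //.
have ij' : i%:R <= j%:R :> R by rewrite ler_nat.
split => /= [k /le/le_trans|]; first exact.
by apply: le_trans ge; rewrite lerN2.
Qed.

End Stopping.

(** * The limit *)

Section Limits.
Context {R : realType} {d : measure_display} {Omega : measurableType d}.
Variables (P : probability Omega R) (xi : nat -> Omega -> R) (F : R -> R)
  (Fil : nat -> set (set Omega)) (sigma : Omega -> option nat).
Hypotheses (mxi : forall n, (0 < n)%N -> measurable_fun setT (xi n))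
  (xiF : forall n, (0 < n)%N -> forall x, P [set w | xi n w <= x] = (F x)%:E)
  (ixi : P.-integrable setT (EFin \o xi 1%N))
  (xi_neg : (\int[P]_w (xi 1%N w)%:E < 0)%E)
  (Flong : long_tailed F) (FS : in_Sstar F)
  (filtration : admissible_filtration P xi Fil) (stopping : stopping_time Fil sigma).

Let T := tail F.
Let a := fine (mplus F).

Let T0 x : 0 < T x. Proof. by case: FS. Qed.

Let T1 x : T x <= 1.
Proof. by rewrite /T /tail gerBl -lee_fin -(xiF (ltn0Sn 0)). Qed.

Let measurable_le n x : (0 < n)%N -> measurable [set w | xi n w <= x].
Proof.
move=> n0; have -> : [set w | xi n w <= x] = [set: Omega] `&` xi n @^-1` `]-oo, x]%classic.
  by rewrite setTI; apply/seteqP; split => w /=; rewrite in_itv.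
exact: mxi.
Qed.

Let Tni : {homo T : x y /~ x <= y}.
Proof.
move=> x y xy; rewrite /T /tail lerD2l lerN2 -lee_fin -!(xiF (ltn0Sn 0)).
apply: le_measure; rewrite ?inE//; [exact: measurable_le|exact: measurable_le|].
by move=> w /= /le_trans; apply.
Qed.

Let xiT n t : P [set w | t < xi n.+1 w] = (T t)%:E.
Proof.
have -> : [set w | t < xi n.+1 w] = ~` [set w | xi n.+1 w <= t].
  by apply/seteqP; split => w /=; rewrite ltNge => /negP.
by rewrite probability_setC ?xiF//; exact: measurable_le.
Qed.

Let Ta : (\int[lebesgue_measure]_(t in `[0%R, +oo[%classic) (T t)%:E = a%:E)%E.
Proof.
rewrite /a fineK// ge0_fin_numE; first by case: FS => _ [].
by apply: integral_ge0 => x _; rewrite lee_fin ltW// T0.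
Qed.

(** The mean is the integral of the upper tail over the positive half-line minus that of the
    distribution function over the negative one. *)
Let Tdrift : (a%:E < \int[lebesgue_measure]_(v in `]-oo, 0%R[%classic) (1 - T v)%:E)%E.
Proof.
pose X : {RV P >-> R} := HB.pack (xi 1%N) (isMeasurableFun.Build _ _ _ _ (xi 1%N) (mxi (ltn0Sn 0))).
have L1 : (X : Omega -> R) \in Lfun P 1 by apply/Lfun1_integrable.
move: xi_neg; rewrite -[X in (X < 0)%E](@expectation_def _ _ _ P X).
rewrite (expectation_cdf_ccdf L1).
have -> : (\int[lebesgue_measure]_(r in `[0%R, +oo[%classic) ccdf X r = a%:E)%E.
  rewrite -Ta; apply: eq_integral => r _; rewrite -(xiT 0).
  by rewrite /ccdf /distribution/= /pushforward; congr (P _);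
    apply/seteqP; split => w /=; rewrite in_itv/= andbT.
have -> : (\int[lebesgue_measure]_(r in `]-oo, 0%R[%classic) cdf X r =
    \int[lebesgue_measure]_(v in `]-oo, 0%R[%classic) (1 - T v)%:E)%E.
  apply: eq_integral => r _; rewrite /T /tail subKr -(xiF (ltn0Sn 0)).
  by rewrite /cdf /distribution/= /pushforward; congr (P _);
    apply/seteqP; split => w /=; rewrite in_itv/=.
by rewrite sube_lt0.
Qed.

Let ratio (x : R) : \bar R :=
  (P [set w | (x%:E < M_st xi sigma w)%E] * ((tail F x)^-1)%:E)%E.

(** First the series for the mean of [sigma] is cut at [N], then positions are confined by [j], both
    keeping the sum above [c]. The slack left absorbs the passage from [T x] to [T (x + j)]. An
    infinite mean is covered too. *)
Lemma M_st_ratio_ge (c : R) : (c%:E < E_st P sigma)%E ->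
  \forall x \near +oo, (c%:E <= ratio x)%E.
Proof.
have ratio0 x : (0 <= ratio x)%E.
  by rewrite mule_ge0// lee_fin invr_ge0 ltW// T0.
case: (leP c 0) => c0; first by move=> _; near=> x; rewrite (@le_trans _ _ 0%E)// lee_fin.
rewrite (E_stE filtration stopping) => cE.
have /(_ _ (open_ereal_gt_ereal cE)) [N _ /(_ N (leqnn N)) /= cN] :=
  @is_cvg_nneseries R (fun n => P (not_stopped sigma n.+1)) xpredT 0 (fun n _ _ => measure_ge0 _ _).
have cvq : \sum_(0 <= n < N) P (quiet xi sigma j%:R n) @[j --> \oo] -->
    (\sum_(0 <= n < N) P (not_stopped sigma n.+1))%E.
  apply: cvg_nnesum => n _; last exact: (cvg_quiet filtration stopping).
  by near=> j; exact: measure_ge0.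
have [j _ /(_ j (leqnn j)) /= cj] := cvq _ (open_ereal_gt_ereal cN).
have sfin : (\sum_(0 <= n < N) P (quiet xi sigma j%:R n) \is a fin_num)%E.
  by apply/sum_fin_numP => n _ _; apply: fin_num_measure; exact: (measurable_quiet filtration stopping).
move: cj; set s := (\sum_(0 <= n < N) _)%E in sfin *.
rewrite -(fineK sfin) lte_fin; set q := fine s => cq.
have q0 : 0 < q by lra.
(* The tolerance [eta = 1 - c / q] is chosen so that [q * (1 - eta) = c]. *)
have eta0 : 0 < 1 - c / q by rewrite subr_gt0 ltr_pdivrMr// mul1r.
have eta1 : 1 - c / q <= 1 by rewrite gerBl divr_ge0// ltW.
have Tlong : forall c : R, 0 < c -> (fun x => T (x - c) / T x) @ +oo --> (1 : R) by case: Flong.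
have nearT := near_tail_add Tni T0 Tlong j%:R eta0 eta1.
near=> x.
have Tx : (1 - (1 - c / q)) * T x <= T (x + j%:R) by near: x.
have jx : j%:R <= x by near: x; apply: nbhs_pinfty_ge; rewrite num_real.
rewrite lee_pdivlMr ?T0//.
apply: le_trans (one_big_jump mxi filtration stopping N jx xiT).
rewrite -ge0_sume_distrl => [|n _]; last exact: measure_ge0.
rewrite -/s -(fineK sfin) -/q -!EFinM lee_fin.
have -> : c * T x = q * ((1 - (1 - c / q)) * T x).
  by rewrite opprB addrCA subrr addr0 mulrA mulrC [q * _]mulrC divfK ?gt_eqF// mulrC.
by rewrite ler_pM2l.
Unshelve. all: by end_near. Qed.

Lemma M_st_ratio_le (eps : R) : 0 < eps ->
  \forall x \near +oo, (ratio x <= (1 + eps)%:E * E_st P sigma)%E.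
Proof.
move=> eps0.
have [_ Tlong] := Flong; have [_ [_ Tconv]] := FS.
have := lyapunov_density Tni T0 T1 Tlong Ta Tconv Tdrift eps0.
apply: filterS => x [kappa [mk k0 kneg k1 drift]].
rewrite lee_pdivrMr ?T0// -muleAC -EFinM.
have c0 : 0 <= (1 + eps) * T x by rewrite mulr_ge0 ?(ltW (T0 x))//; lra.
apply: (lyapunov_crossing mxi filtration stopping (h := primitive kappa)) => //.
- exact: measurable_primitive.
- exact: primitive_ge0.
- rewrite /primitive; apply: integral0_eq => u /=; rewrite in_itv/= => u0.
  by rewrite kneg// ltW.
- move=> s xs; apply: (le_trans k1); apply: le_primitive => //; exact: ltW.
move=> n s sx.
rewrite (integral_primitive_translate mk k0 s (mxi (ltn0Sn n)) (xiT n)).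
exact: drift.
Qed.

Lemma cvg_M_st_ratio : ratio @ +oo --> E_st P sigma.
Proof.
have E0 : (0 <= E_st P sigma)%E.
  by apply: integral_ge0 => w _; rewrite /st_ext; case: (sigma w) => // n; rewrite lee_fin.
have ratio0 x : (0 <= ratio x)%E.
  by rewrite mule_ge0// lee_fin invr_ge0 ltW// T0.
case: (eqVneq (E_st P sigma) +oo%E) => [Eoo|Efin].
  rewrite Eoo; apply/cvgeyPge => A; apply: M_st_ratio_ge.
  by rewrite Eoo ltry.
have Efn : E_st P sigma \is a fin_num by rewrite ge0_fin_numE// lt_neqAle Efin leey.
have le_ := M_st_ratio_le; have ge_ := M_st_ratio_ge.
rewrite -(fineK Efn); set e := fine _.
rewrite -(fineK Efn) -/e in le_ ge_.
have e0 : 0 <= e by rewrite fine_ge0.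
have rfin : \forall x \near +oo, ratio x \is a fin_num.
  have := le_ 1 ltr01; apply: filterS => x rx.
  by rewrite ge0_fin_numE// (le_lt_trans rx)// -EFinM ltry.
apply/fine_cvgP; split => //.
apply/cvgrPdist_le => eps eps0.
(* The denominator is [e + 1] because the mean [e] may be 0. *)
have eps1 : 0 < eps / (e + 1) by rewrite divr_gt0//; lra.
have near_le := le_ _ eps1.
have near_ge := ge_ (e - eps).
have {}near_ge : \forall x \near +oo, ((e - eps)%:E <= ratio x)%E.
  by apply: near_ge; rewrite lte_fin; lra.
near=> x.
have rx : ratio x \is a fin_num by near: x.
have h1 : (ratio x <= (1 + eps / (e + 1))%:E * e%:E)%E by near: x.
have h2 : ((e - eps)%:E <= ratio x)%E by near: x.
move: h1 h2; rewrite -(fineK rx) -EFinM !lee_fin/= => h1 h2.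
have h3 : eps / (e + 1) * e <= eps.
  rewrite -mulrA ler_piMr ?(ltW eps0)// mulrC ler_pdivrMr; lra.
by rewrite ler_distlC; apply/andP; split; lra.
Unshelve. all: by end_near. Qed.

End Limits.

Unset Implicit Arguments.

Theorem theorem1 (R : realType) (d : measure_display) (Omega : measurableType d)
  (P : probability Omega R) (xi : nat -> Omega -> R) (F : R -> R)
  (Fil : nat -> set (set Omega)) (sigma : Omega -> option nat) :
  (forall n, (0 < n)%N -> measurable_fun setT (xi n)) ->
  mutually_independent P xi ->
  (forall n, (0 < n)%N -> forall x, P [set w | xi n w <= x] = (F x)%:E) ->
  P.-integrable setT (EFin \o xi 1%N) ->
  (\int[P]_w (xi 1%N w)%:E < 0)%E ->
  long_tailed F ->
  in_Sstar F ->
  admissible_filtration P xi Fil ->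
  stopping_time Fil sigma ->
  (fun x => (P [set w | (x%:E < M_st xi sigma w)%E] * ((tail F x)^-1)%:E)%E)
    @ +oo --> E_st P sigma.
Proof.
move=> mxi _ xiF ixi xi_neg Flong FS filtration stopping.
exact: (cvg_M_st_ratio mxi xiF ixi xi_neg Flong FS filtration stopping).
Qed.
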